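(* Let $t:\mathbb{N}\to\mathbb{N}$ satisfy $t(n)>n$ and be computable in time $O(t(n))$. Then there exists a language $L\subseteq\{0,1\}^*$ that is almost everywhere nonempty, that cannot be decided by any randomized RAM within time $O(t(n))$, but that can be decided by a deterministic RAM in time $O\big(2^{t(n)^{2.01}}\big)$.
   Context: RAM means the logarithmic-cost random access machine of Cook and Reckhow (register operations cost logarithmically in the magnitudes involved), with the input given on a read-once input tape, augmented for randomized machines with an $O(1)$-cost coin-flip operation. A randomized machine decides $L$ if on each input it answers correctly with probability at least $2/3$. A set $S\subseteq\{0,1\}^*$ is almost everywhere nonempty if $S\cap\{0,1\}^n\neq\emptyset$ for all but finitely many $n$. A function $t$ is computable in time $s(n)$ if an algorithm given $n$ in binary outputs $t(n)$ in time $s(n)$. *)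

(* Defs.v *)
From HB Require Import structures.
From mathcomp Require Import all_boot all_order all_algebra.
From mathcomp Require Import all_classical all_reals all_analysis.
Import Order.TTheory GRing.Theory Num.Theory numFieldNormedType.Exports.

Set Implicit Arguments.
Unset Strict Implicit.
Unset Printing Implicit Defensive.

Local Open Scope ring_scope.

(* The instruction set and the logarithmic costs are those of S. Cook and
   R. Reckhow, "Time bounded random access machines" (JCSS 7, 1973), plus IFlip.
   X_i denotes the contents of register i. *)
Inductive instr : Type :=
| IConst (i : nat) (z : int)   (* X_i <- z *)
| IAdd (i j k : nat)           (* X_i <- X_j + X_k *)
| ISub (i j k : nat)           (* X_i <- X_j - X_k *)
| ILoad (i j : nat)            (* X_i <- X_(X_j) *)
| IStore (i j : nat)           (* X_(X_i) <- X_j *)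
| IJump (m j : nat)            (* go to instruction m if X_j > 0 *)
| IRead (i : nat)              (* X_i <- next input symbol *)
| IPrint (i : nat)             (* append X_i to the output *)
| IFlip (i : nat).             (* X_i <- a fair coin flip, 0 or 1 *)

Definition program := seq instr.

Definition deterministic (M : program) : bool :=
  all (fun ins => if ins is IFlip _ then false else true) M.

Record config : Type := Config {
  pc : nat;
  regs : nat -> int;
  inp : seq bool;
  out : seq int;
  clock : nat }.

Definition init (x : seq bool) : config := Config 0 (fun=> 0) x [::] 0.

(* ceil (log_2 |z|) for |z| >= 2, and 1 for |z| <= 1 *)
Definition logcost (z : int) : nat := maxn 1 (up_log 2 `|z|%N).

Definition assign (c : config) (i : nat) (v : int) (cost : nat) : config :=
  Config (pc c).+1 [eta regs c with i |-> v] (inp c) (out c)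
         (clock c + cost)%N.

(* The input bits 0 and 1 are read as 1 and 2; 0 is read past the end. *)
Definition next_symbol (x : seq bool) : int :=
  if x is d :: _ then d.+1%:Z else 0.

(* The result None means that no step is possible, i.e. the machine has halted:
   this is the case for an indirect access through a negative address. *)
Definition exec (ins : instr) (coin : bool) (c : config) : option config :=
  let X := regs c in
  match ins with
  | IConst i z => Some (assign c i z 1)
  | IAdd i j k => Some (assign c i (X j + X k) (logcost (X j) + logcost (X k)))
  | ISub i j k => Some (assign c i (X j - X k) (logcost (X j) + logcost (X k)))
  | ILoad i j =>
      if X j is Posz a
      then Some (assign c i (X a) (logcost (X j) + logcost (X a))) else None
  | IStore i j =>
      if X i is Posz a
      then Some (assign c a (X j) (logcost (X i) + logcost (X j))) else None
  | IJump m j =>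
      Some (Config (if 0 < X j then m else (pc c).+1) X (inp c) (out c)
                   (clock c + logcost (X j))%N)
  | IRead i =>
      let v := next_symbol (inp c) in
      Some (Config (pc c).+1 [eta X with i |-> v] (behead (inp c)) (out c)
                   (clock c + logcost v)%N)
  | IPrint i =>
      Some (Config (pc c).+1 X (inp c) (rcons (out c) (X i))
                   (clock c + logcost (X i))%N)
  | IFlip i => Some (assign c i (coin : nat)%:Z 1)
  end.

(* The program ends when control leaves it. *)
Definition step (M : program) (coin : bool) (c : config) : option config :=
  if onth M (pc c) is Some ins then exec ins coin c else None.

Definition halted (M : program) (c : config) : bool :=
  ~~ isSome (step M false c).

(* Runs M for size r steps (or until it halts); the i-th step uses the i-th
   coin of r if it is an IFlip, and otherwise ignores it. *)
Definition run (M : program) (x : seq bool) (r : seq bool) : config :=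
  foldl (fun c b => odflt c (step M b c)) (init x) r.

(* Every step costs at least 1, so a computation of cost at most T has at most
   T steps, and T coins determine it. *)
Definition halts_within (M : program) (x : seq bool) (T : nat) : Prop :=
  forall r : T.-tuple bool,
    halted M (run M x r) /\ (clock (run M x r) <= T)%N.

(* The probability, over T fair coins, that the output of M on x is o. *)
Definition prob_output (M : program) (x : seq bool) (T : nat) (o : seq int) :
    rat :=
  #|[set r : T.-tuple bool | out (run M x r) == o]|%:R / (2 ^ T)%:R.

Definition computes_within (M : program) (x : seq bool) (T : nat)
    (o : seq int) : Prop :=
  halts_within M x T /\ forall r : T.-tuple bool, out (run M x r) = o.

Definition language := pred (seq bool).

(* A machine accepts by printing 1 and rejects by printing 0. *)
Definition answer (b : bool) : seq int := [:: (b : nat)%:Z].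

Definition rand_decides_within (M : program) (L : language) (T : nat -> nat) :
    Prop :=
  forall x : seq bool,
    halts_within M x (T (size x)) /\
    2%:R / 3%:R <= prob_output M x (T (size x)) (answer (L x)).

Definition det_decides_within (M : program) (L : language) (T : nat -> nat) :
    Prop :=
  deterministic M /\
  forall x : seq bool, computes_within M x (T (size x)) (answer (L x)).

(* The binary numeral of n, most significant digit first; that of 0 is "0". *)
Definition binary (n : nat) : seq bool :=
  [seq odd (n %/ 2 ^ i) | i <- rev (iota 0 (trunc_log 2 n).+1)].

(* M prints f n as a single integer; T is a function of n, not of the length
   of its numeral. *)
Definition det_computes_fun_within (M : program) (f : nat -> nat)
    (T : nat -> nat) : Prop :=
  deterministic M /\
  forall n : nat, computes_within M (binary n) (T n) [:: (f n)%:Z].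

Local Open Scope classical_set_scope.

Definition time_O (R : realType) (T : nat -> nat) (g : nat -> R) : Prop :=
  (fun n => (T n)%:R : R) =O_\oo g.

Definition computable_in_time_O (R : realType) (f : nat -> nat)
    (g : nat -> R) : Prop :=
  exists (M : program) (T : nat -> nat),
    time_O T g /\ det_computes_fun_within M f T.

Definition rand_decidable_in_time_O (R : realType) (L : language)
    (g : nat -> R) : Prop :=
  exists (M : program) (T : nat -> nat),
    time_O T g /\ rand_decides_within M L T.

Definition det_decidable_in_time_O (R : realType) (L : language)
    (g : nat -> R) : Prop :=
  exists (M : program) (T : nat -> nat),
    time_O T g /\ det_decides_within M L T.

Definition ae_nonempty (S : language) : Prop :=
  exists N : nat, forall n : nat, (N <= n)%N ->
    exists x : seq bool, size x = n /\ S x.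

(* Main.v *)
(** The language diagonalizes against randomized machines run for [S = t(n)^2]
steps.  A string is read as the code of a program followed by padding; [x] is
in [L] unless more than half of the [2^S] coin sequences make its program
print 1 on [x] within [S] steps.  If [M] runs in time [O(t)], a sufficiently
padded code of [M] has [S] at least the running time, and [M] errs on it.  The
string [0^n] codes a program that halts at once, so it belongs to [L].

A deterministic machine decides [L] by simulating all [2^S] runs.  The
magnitudes of its registers at most double at each step, so a computation of
[N] steps has logarithmic cost [O(N^2)].  As [N <= 2^(2S)] up to a constant,
the cost is [O(2^(4 t^2))], and [4 t^2 <= t^2.01] once [t >= 4^100]: only steps
have to be counted, and the simulation may be wasteful.  *)

Require Import Defs.
From mathcomp Require Import all_boot all_order all_algebra.
From mathcomp Require Import all_classical all_reals all_analysis.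
From mathcomp Require Import zify ring.
Import Order.TTheory GRing.Theory Num.Theory.

Set Implicit Arguments.
Unset Strict Implicit.
Unset Printing Implicit Defensive.

(** * Runs of a program given by its fetch function *)

(** Bounded error is not a syntactic property, so the machines to be defeated cannot be listed among
    all programs. A strict majority vote makes sense for every program, and the gap between 1/2 and
    2/3 is used only in the final contradiction.

    The square in [S] absorbs the unknown constant of [O(t)]: since [t n > n], the bound
    [C * t n <= t n * t n] holds from [n = C] on, and padding reaches such lengths for each [C].
    Simulated runs are cut off after [S] steps, not at cost [S]. A step costs at least 1, so a run
    of cost at most [S] has halted by then, and the decider never evaluates a logarithm.

    The main obstacle is that the decider must be an actual RAM program with a proved running time.
    It is written in a small structured language, whose compiler is proved correct with an exact
    step count. A single interpreter serves twice: for the program coded by the input and for the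
    machine that computes [t], whose code is a constant of the decider. *)

Definition code_exec (code : nat -> option instr) (b : bool) (c : config) :
    option config :=
  if code (pc c) is Some ins then exec ins b c else None.

Definition code_step (code : nat -> option instr) (c : config) (b : bool) :
    config := odflt c (code_exec code b c).

Definition code_run (code : nat -> option instr) (c : config) (r : seq bool) :
    config := foldl (code_step code) c r.

Definition code_halted (code : nat -> option instr) (c : config) : bool :=
  ~~ isSome (code_exec code false c).

(** Inputs decode to fetch functions defined at every position, not to lists of instructions. Runs
    are therefore studied for fetch functions, and a program [M] enters as [onth M]. *)
Lemma runE (M : program) (x r : seq bool) :
  run M x r = code_run (onth M) (init x) r.
Proof. by []. Qed.

(** A step fails only for lack of an instruction or because of a negative address. This justifies
    testing [code_halted] with the coin 0 alone. *)
Lemma code_exec_coin (code : nat -> option instr) (b : bool) (c : config) :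
  isSome (code_exec code b c) = isSome (code_exec code false c).
Proof.
rewrite /code_exec; case: (code _) => // -[] //= *; by case: (regs c _).
Qed.

Lemma code_step_halted (code : nat -> option instr) (c : config) (b : bool) :
  code_halted code c -> code_step code c b = c.
Proof.
rewrite /code_halted -(code_exec_coin code b) /code_step.
by case: (code_exec _ _ _).
Qed.

Lemma code_run_halted (code : nat -> option instr) (c : config)
    (r : seq bool) :
  code_halted code c -> code_run code c r = c.
Proof. by move=> hc; elim: r => //= b r IH; rewrite code_step_halted. Qed.

Lemma code_run_cat (code : nat -> option instr) (c : config)
    (r r' : seq bool) :
  code_run code c (r ++ r') = code_run code (code_run code c r) r'.
Proof. exact: foldl_cat. Qed.

(* Every register of index above B is still blank, so B also bounds the
   addresses used so far. *)
Definition small_regs (B : nat) (c : config) : Prop :=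
  (forall a, `|regs c a| <= B)%N /\ (forall a, B < a -> regs c a = 0%R)%N.

(** Only the addresses and constants that an instruction brings in by itself matter. [IStore] writes
    at an address held in a register, which [small_regs] already bounds, and reading a blank
    register yields 0. *)
Definition instr_bound (B : nat) (ins : instr) : bool :=
  match ins with
  | IConst i z => (i <= B) && (`|z|%N <= B)
  | IAdd i j k | ISub i j k => i <= B
  | ILoad i j => i <= B
  | IRead i | IFlip i => i <= B
  | _ => true
  end.

Lemma small_regsW (B B' : nat) (c : config) :
  B <= B' -> small_regs B c -> small_regs B' c.
Proof.
move=> le [h1 h2]; split=> a; first exact: leq_trans (h1 a) le.
by move=> lt; apply: h2; apply: leq_ltn_trans lt.
Qed.

Lemma small_regs_assign (B : nat) (c : config) (i : nat) (v : int)
    (cost : nat) :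
  i <= B -> (`|v|%N <= B) -> small_regs B c ->
  small_regs B (assign c i v cost).
Proof.
move=> hi hv [h1 h2]; split=> a /=; case: eqP => // [->|_ /h2 //].
by lia.
Qed.

(** Addition and subtraction at most double the magnitudes; [2 <= B] accommodates the input symbols,
    which go up to 2. *)
Lemma small_regs_exec (B : nat) (ins : instr) (b : bool) (c c' : config) :
  2 <= B -> instr_bound B ins -> small_regs B c -> exec ins b c = Some c' ->
  small_regs (B + B) c'.
Proof.
move=> B2 hi h; have h' := small_regsW (leq_addr B B) h; case: (h) => h1 h2.
case: ins hi => /=.
- by move=> i z /andP[? ?] [<-]; apply: small_regs_assign => //; lia.
- move=> i j k ? [<-]; apply: small_regs_assign => //; first lia.
  by have := h1 j; have := h1 k; lia.
- move=> i j k ? [<-]; apply: small_regs_assign => //; first lia.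
  by have := h1 j; have := h1 k; lia.
- move=> i j ?; case: (regs c j) => // a [<-].
  apply: small_regs_assign => //; first lia.
  by have := h1 a; lia.
- move=> i j _; have := h1 i; case: (regs c i) => // a ? [<-].
  by apply: small_regs_assign => //; [lia | have := h1 j; lia].
- by move=> m j _ [<-].
- move=> i ? [<-]; apply: (@small_regs_assign _ c i (next_symbol (inp c)) 0)
    => //; first lia.
  by rewrite /next_symbol; case: (inp c) => [|[] ?] /=; lia.
- by move=> i _ [<-].
- by move=> i ? [<-]; apply: small_regs_assign => //; [lia | case: b; lia].
Qed.

Lemma logcost_le (z : int) (m : nat) : `|z|%N <= 2 ^ m -> logcost z <= m.+1.
Proof.
move=> h; rewrite /logcost geq_max /=.
by apply: leq_trans (leqnSn m); apply: up_log_min.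
Qed.

Lemma clock_exec (m : nat) (ins : instr) (b : bool) (c c' : config) :
  small_regs (2 ^ m) c -> exec ins b c = Some c' ->
  clock c' <= clock c + 2 * m.+1.
Proof.
move=> [h1 _]; have h a : logcost (regs c a) <= m.+1 by apply: logcost_le.
case: ins => /=.
- by move=> i z [<-] /=; lia.
- by move=> i j k [<-] /=; have := h j; have := h k; lia.
- by move=> i j k [<-] /=; have := h j; have := h k; lia.
- move=> i j; have := h j; case: (regs c j) => // a ? [<-] /=.
  by have := h a; lia.
- move=> i j; have := h i; case: (regs c i) => // a ? [<-] /=.
  by have := h j; lia.
- by move=> k j [<-] /=; have := h j; lia.
- move=> i [<-] /=; suff : logcost (next_symbol (inp c)) <= 1 by lia.
  by rewrite /logcost geq_max /=; apply: up_log_min => //;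
    case: (inp c) => [|[]].
- by move=> i [<-] /=; have := h i; lia.
- by move=> i [<-] /=; lia.
Qed.

Definition code_bound (B : nat) (code : nat -> option instr) : Prop :=
  forall p ins, code p = Some ins -> instr_bound B ins.

Lemma small_regs_run (code : nat -> option instr) (B : nat) (c : config)
    (r : seq bool) :
  2 <= B -> code_bound B code -> small_regs B c ->
  small_regs (B * 2 ^ size r) (code_run code c r).
Proof.
move=> B2 hcode h; elim/last_ind: r => [|r b IH]; first by rewrite muln1.
rewrite /code_run foldl_rcons -/(code_run code c r) size_rcons expnS mulnCA.
rewrite mul2n -addnn /code_step /code_exec.
case e: (code _) => [ins|] /=; last by apply: small_regsW IH; rewrite leq_addr.
have BB : B <= B * 2 ^ size r by rewrite leq_pmulr ?expn_gt0.
case e': (exec _ _ _) => [c'|] /=;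
  last by apply: small_regsW IH; rewrite leq_addr.
apply: small_regs_exec e' => //; first exact: leq_trans B2 BB.
have := hcode _ _ e; move: BB; set B' := B * _ => BB.
case: ins {e} => //= *; by lia.
Qed.

Lemma clock_run (code : nat -> option instr) (B : nat) (c : config)
    (r : seq bool) :
  2 <= B -> code_bound B code -> small_regs B c ->
  clock (code_run code c r) <= clock c + size r * (2 * (B + size r).+1).
Proof.
move=> B2 hcode h; elim/last_ind: r => [|r b IH]; first by rewrite addn0.
have := small_regs_run r B2 hcode h; move: IH.
rewrite /code_run foldl_rcons -/(code_run code c r) size_rcons.
move=> IH hs.
suff : clock (code_step code (code_run code c r) b) <=
  clock (code_run code c r) + 2 * (B + size r).+1 by nia.
rewrite /code_step /code_exec.
case e: (code _) => [ins|] /=; last by rewrite leq_addr.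
case e': (exec _ _ _) => [c'|] /=; last by rewrite leq_addr.
(* Since [B < 2 ^ B], all registers stay below [2 ^ (B + size r)]: each step costs a linear amount,
   and the run a quadratic one. *)
apply: clock_exec e'; apply: small_regsW hs.
by rewrite expnD leq_mul2r (ltnW (ltn_expl _ _)) ?orbT.
Qed.

Lemma small_regs_init (B : nat) (x : seq bool) : small_regs B (init x).
Proof. by []. Qed.

Lemma code_run_deterministic (M : program) (c : config) (r : seq bool) :
  deterministic M ->
  code_run (onth M) c r = iter (size r) (fun c' =>
    code_step (onth M) c' false) c.
Proof.
move=> det; have e c' b : code_step (onth M) c' b = code_step (onth M) c' false.
  rewrite /code_step /code_exec; case h: (onth M _) => [ins|//].
  case: ins h => //= i h.
  have lt : pc c' < size M by rewrite -onthTE h.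
  have := elimT (all_nthP (IConst 0 0%R)) det _ lt.
  by rewrite (onth_nth _ _ _ _ h).
elim: r c => //= b r IH c; rewrite IH e.
by rewrite -[LHS]iterSr.
Qed.

(** * A structured language compiled to the RAM *)

(* Source language of the decider: variables v_1, ..., v_62 and eight infinite
   arrays of integers.  Tests ask whether a variable is positive. *)
Inductive cmd : Type :=
| Const (i : nat) (z : int)
| Add (i j k : nat)
| Sub (i j k : nat)
| Get (i a k : nat)             (* v_i <- a[v_k] *)
| Put (a k i : nat)             (* a[v_k] <- v_i *)
| Read (i : nat)
| Print (i : nat)
| Skip
| Seq (c d : cmd)
| If (j : nat) (c d : cmd)
| While (j : nat) (c : cmd).

Record state : Type := State {
  var : nat -> int;
  arr : nat -> nat -> int;
  tape : seq bool;
  printed : seq int;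
  time : nat }.

Definition upd (T : Type) (f : nat -> T) (i : nat) (v : T) : nat -> T :=
  fun j => if j == i then v else f j.

Definition tick (k : nat) (s : state) : state :=
  State (var s) (arr s) (tape s) (printed s) (time s + k).

Definition set_var (i : nat) (v : int) (k : nat) (s : state) : state :=
  State (upd (var s) i v) (arr s) (tape s) (printed s) (time s + k).

Definition set_arr (a i : nat) (v : int) (k : nat) (s : state) : state :=
  State (var s) (upd (arr s) a (upd (arr s a) i v)) (tape s) (printed s)
        (time s + k).

(* [time] counts the machine steps of the compiled command. *)
Inductive ev : cmd -> state -> state -> Prop :=
| ev_const i z s : ev (Const i z) s (set_var i z 1 s)
| ev_add i j k s : ev (Add i j k) s (set_var i (var s j + var s k)%R 1 s)
| ev_sub i j k s : ev (Sub i j k) s (set_var i (var s j - var s k)%R 1 s)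
| ev_get i a k s n : var s k = Posz n ->
    ev (Get i a k) s (set_var i (arr s a n) 6 s)
| ev_put a k i s n : var s k = Posz n ->
    ev (Put a k i) s (set_arr a n (var s i) 6 s)
| ev_read i s :
    ev (Read i) s
      (State (upd (var s) i (next_symbol (tape s))) (arr s)
             (behead (tape s)) (printed s) (time s + 1))
| ev_print i s :
    ev (Print i) s
      (State (var s) (arr s) (tape s) (rcons (printed s) (var s i))
             (time s + 1))
| ev_skip s : ev Skip s s
| ev_seq c d s s' s'' : ev c s s' -> ev d s' s'' -> ev (Seq c d) s s''
| ev_if_true j c d s s' :
    (0 < var s j)%R -> ev c (tick 1 s) s' -> ev (If j c d) s s'
| ev_if_false j c d s s' :
    ~~ (0 < var s j)%R -> ev d (tick 1 s) s' -> ev (If j c d) s (tick 2 s')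
| ev_while_true j c s s' s'' :
    (0 < var s j)%R -> ev c (tick 1 s) s' ->
    ev (While j c) (tick 2 s') s'' -> ev (While j c) s s''
| ev_while_false j c s :
    ~~ (0 < var s j)%R -> ev (While j c) s (tick 3 s).

(** Three doublings replace a multiplication by 8. With the access itself this makes the 6 steps
    charged to [Get] and [Put]. *)
Definition address (a : nat) (k : nat) : program :=
  [:: IAdd 0 k k; IAdd 0 0 0; IAdd 0 0 0; IConst 63 (Posz (64 + a));
    IAdd 0 0 63].

(** Jumps are conditional, so a positive value is loaded first; hence two steps, the [tick 2] of the
    evaluation rules. *)
Definition goto (m : nat) : program := [:: IConst 63 1%R; IJump m 63].

Fixpoint csize (c : cmd) : nat :=
  match c with
  | Get _ _ _ | Put _ _ _ => 6
  | Skip => 0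
  | Seq c d => csize c + csize d
  | If _ c d => 3 + csize d + csize c
  | While _ c => 5 + csize c
  | _ => 1
  end.

(* Position-dependent because jumps are absolute.  Entry i of array a is
   register 64 + 8 i + a; registers 0 and 63 are scratch. *)
Fixpoint compile (p : nat) (c : cmd) : program :=
  match c with
  | Const i z => [:: IConst i z]
  | Add i j k => [:: IAdd i j k]
  | Sub i j k => [:: ISub i j k]
  | Get i a k => address a k ++ [:: ILoad i 0]
  | Put a k i => address a k ++ [:: IStore 0 i]
  | Read i => [:: IRead i]
  | Print i => [:: IPrint i]
  | Skip => [::]
  | Seq c d => compile p c ++ compile (p + csize c) d
  | If j c d =>
      IJump (p + 3 + csize d) j :: compile p.+1 d ++
      goto (p + 3 + csize d + csize c) ++ compile (p + 3 + csize d) c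
  | While j c =>
      [:: IJump (p + 3) j & goto (p + 5 + csize c)] ++
      compile (p + 3) c ++ goto p
  end.

Definition is_var (i : nat) : bool := 0 < i < 63.

Fixpoint wf (c : cmd) : bool :=
  match c with
  | Const i _ | Read i | Print i => is_var i
  | Add i j k | Sub i j k => [&& is_var i, is_var j & is_var k]
  | Get i a k | Put a k i => [&& is_var i, is_var k & a < 8]
  | Skip => true
  | Seq c d => wf c && wf d
  | If j c d => [&& is_var j, wf c & wf d]
  | While j c => is_var j && wf c
  end.

Lemma size_compile (p : nat) (c : cmd) : size (compile p c) = csize c.
Proof.
elim: c p => //= [c IHc d IHd|j c IHc d IHd|j c IHc] p.
- by rewrite size_cat IHc IHd.
- by rewrite !size_cat /= IHc IHd; lia.
- by rewrite !size_cat /= IHc; lia.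
Qed.

Lemma deterministic_compile (p : nat) (c : cmd) : deterministic (compile p c).
Proof.
rewrite /deterministic.
elim: c p => //= [c IHc d IHd|j c IHc d IHd|j c IHc] p;
  by rewrite !all_cat /= ?IHc ?IHd.
Qed.

Definition code_at (M : program) (p : nat) (l : program) : Prop :=
  forall i, i < size l -> onth M (p + i) = onth l i.

Lemma code_at_cat (M : program) (p : nat) (l l' : program) :
  code_at M p (l ++ l') -> code_at M p l /\ code_at M (p + size l) l'.
Proof.
move=> h; split=> i lt.
  by rewrite h ?size_cat ?onth_cat ?lt // ltn_addr.
rewrite -addnA h ?size_cat ?ltn_add2l // onth_cat.
by rewrite ltnNge leq_addr /= addKn.
Qed.

Lemma code_at_cons (M : program) (p : nat) (ins : instr) (l : program) :
  code_at M p (ins :: l) -> onth M p = Some ins /\ code_at M p.+1 l.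
Proof.
move=> h; split; first by have := h 0 isT; rewrite addn0.
by move=> i lt; rewrite addSnnS h.
Qed.

Definition steps (M : program) (k : nat) (c c' : config) : Prop :=
  iter k (fun c => code_step (onth M) c false) c = c'.

Lemma steps_trans (M : program) (k k' : nat) (c c' c'' : config) :
  steps M k c c' -> steps M k' c' c'' -> steps M (k + k') c c''.
Proof. by rewrite /steps addnC iterD => -> ->. Qed.

Lemma steps1 (M : program) (c : config) (ins : instr) :
  onth M (pc c) = Some ins ->
  steps M 1 c (odflt c (exec ins false c)).
Proof. by move=> h; rewrite /steps /= /code_step /code_exec h. Qed.

(** The scratch registers 0 and 63, the program counter and the clock are left free, so that address
    computations and jumps preserve the relation. *)
Definition represents (s : state) (c : config) : Prop :=
  [/\ forall i, is_var i -> regs c i = var s i,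
      forall a i, a < 8 -> regs c (64 + 8 * i + a) = arr s a i,
      inp c = tape s & out c = printed s].

Lemma represents_set_var (i k n : nat) (v : int) (s : state) (c : config) :
  is_var i -> represents s c ->
  represents (set_var i v k s) (assign c i v n).
Proof.
move=> hi [h1 h2 h3 h4]; split=> //= [j hj|a j ha].
  by rewrite /upd; case: eqP => // _; apply: h1.
rewrite -h2 //; case: eqP => // e; move: hi; rewrite /is_var; lia.
Qed.

Lemma represents_scratch (i n : nat) (v : int) (s : state) (c : config) :
  (i == 0) || (i == 63) -> represents s c -> represents s (assign c i v n).
Proof.
move=> hi [h1 h2 h3 h4]; split=> //= [j hj|a j ha].
  by rewrite -h1 //; case: eqP => // e; move: hi hj; rewrite /is_var; lia.
by rewrite -h2 //; case: eqP => // e; move: hi; lia.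
Qed.

Lemma represents_set_arr (a i k n : nat) (v : int) (s : state) (c : config) :
  a < 8 -> represents s c ->
  represents (set_arr a i v k s) (assign c (64 + 8 * i + a) v n).
Proof.
move=> hi [h1 h2 h3 h4]; split=> //= [j hj|b j hb].
  rewrite -h1 //; case: eqP => // e; move: hj; rewrite /is_var; lia.
rewrite /upd; case: (eqVneq b a) => [->|ne].
  case: (eqVneq j i) => [->|ne']; first by rewrite eqxx.
  by rewrite -h2 //; case: eqP => // e; exfalso; move/eqP: ne'; lia.
by rewrite -h2 //; case: eqP => // e; exfalso; move/eqP: ne; lia.
Qed.

Lemma steps_address (M : program) (s : state) (c : config) (a k n : nat) :
  is_var k -> var s k = Posz n -> represents s c ->
  code_at M (pc c) (address a k) ->
  exists c', [/\ steps M 5 c c', pc c' = pc c + 5, represents s c'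
               & regs c' 0 = (Posz (64 + 8 * n + a))].
Proof.
move=> hk hn hr.
do 5![case/code_at_cons => ?]; move=> _.
have vk : regs c k = Posz n by case: (hr) => ->.
set c1 := assign c 0 (Posz (n + n)) (logcost n + logcost n).
set c2 := assign c1 0 (Posz (4 * n)) (logcost (Posz (n + n)) + logcost (Posz
  (n + n))).
set c3 := assign c2 0 (Posz (8 * n)) (logcost (Posz (4 * n)) + logcost (Posz
  (4 * n))).
set c4 := assign c3 63 (Posz (64 + a)) 1.
exists (assign c4 0 (Posz (64 + 8 * n + a))
  (logcost (Posz (8 * n)) + logcost (Posz (64 + a)))).
split=> //; last 1 first.
- by do 5!apply: represents_scratch => //.
- have e1 : steps M 1 c c1.
    have := @steps1 M c (IAdd 0 k k); rewrite /= vk; exact.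
  have e2 : steps M 1 c1 c2.
    have := @steps1 M c1 (IAdd 0 0 0); rewrite /= -PoszD.
    by rewrite (_ : n + n + (n + n) = 4 * n); [exact | lia].
  have e3 : steps M 1 c2 c3.
    have := @steps1 M c2 (IAdd 0 0 0); rewrite /= -PoszD.
    by rewrite (_ : 4 * n + 4 * n = 8 * n); [exact | lia].
  have e4 : steps M 1 c3 c4 by have := @steps1 M c3 (IConst 63 (Posz (64 +
    a))); exact.
  have e5 := @steps1 M c4 (IAdd 0 0 63).
  apply: (steps_trans e1); apply: (steps_trans e2); apply: (steps_trans e3).
  apply: (steps_trans e4); move: e5; rewrite /= -PoszD.
  by rewrite (_ : 8 * n + (64 + a) = 64 + 8 * n + a); [exact | lia].
- by rewrite /=; lia.
Qed.

Lemma steps_goto (M : program) (s : state) (c : config) (m : nat) :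
  represents s c -> code_at M (pc c) (goto m) ->
  exists c', [/\ steps M 2 c c', pc c' = m & represents s c'].
Proof.
move=> hr; do 2![case/code_at_cons => ?]; move=> _.
have e1 : steps M 1 c (assign c 63 1%R 1).
  by have := @steps1 M c (IConst 63 1%R); exact.
have e2 := @steps1 M (assign c 63 1%R 1) (IJump m 63).
exists (Config m (regs (assign c 63 1%R 1)) (inp c) (out c)
  (clock c + 1 + logcost 1)); split=> //.
  by apply: (steps_trans e1); apply: e2.
by apply: represents_scratch 1 _ _ _ _ hr.
Qed.

(** The induction is on the evaluation, because a loop evaluates to itself after each pass. The step
    count is exact, which lets all later time bounds be proved on the source language. *)
Lemma compile_correct (M : program) (c : cmd) (s s' : state) :
  ev c s s' -> forall conf, wf c -> represents s conf ->
  code_at M (pc conf) (compile (pc conf) c) ->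
  exists k conf', [/\ time s' = time s + k, steps M k conf conf',
    pc conf' = pc conf + csize c & represents s' conf'].
Proof.
elim=> {c s s'}.
- move=> i z s conf hi hr /code_at_cons[/steps1 st _].
  exists 1; eexists; split; [by [] | exact: st | by rewrite /= addn1 |].
  exact: represents_set_var.
- move=> i j k s conf /and3P[hi hj hk] hr /code_at_cons[/steps1 st _].
  exists 1; eexists; split; [by [] | exact: st | by rewrite /= addn1 |].
  case: (hr) => h _ _ _; rewrite /= !h //; exact: represents_set_var.
- move=> i j k s conf /and3P[hi hj hk] hr /code_at_cons[/steps1 st _].
  exists 1; eexists; split; [by [] | exact: st | by rewrite /= addn1 |].
  case: (hr) => h _ _ _; rewrite /= !h //; exact: represents_set_var.
- move=> i a k s n hn conf /and3P[hi hk ha] hr.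
  rewrite -[compile _ _]/(address a k ++ [:: ILoad i 0]) =>
    /code_at_cat[ha1 ha2].
  have [c' [st epc hr' e0]] := steps_address hk hn hr ha1.
  have [/steps1 st' _] : onth M (pc c') = Some (ILoad i 0) /\ True.
    by case/code_at_cons: ha2; rewrite epc.
  exists (5 + 1), (assign c' i (arr s a n)
    (logcost (regs c' 0) + logcost (arr s a n))); split=> //.
  + apply: (steps_trans st); move: st'; rewrite /= e0 /=.
    by case: (hr') => _ -> //.
  + by rewrite /= epc; lia.
  + exact: represents_set_var.
- move=> a k i s n hn conf /and3P[hi hk ha] hr.
  rewrite -[compile _ _]/(address a k ++ [:: IStore 0 i]) =>
    /code_at_cat[ha1 ha2].
  have [c' [st epc hr' e0]] := steps_address hk hn hr ha1.
  have [/steps1 st' _] : onth M (pc c') = Some (IStore 0 i) /\ True.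
    by case/code_at_cons: ha2; rewrite epc.
  exists (5 + 1), (assign c' (64 + 8 * n + a) (var s i)
    (logcost (regs c' 0) + logcost (var s i))); split=> //.
  + apply: (steps_trans st); move: st'; rewrite /= e0 /=.
    by case: (hr') => -> //.
  + by rewrite /= epc; lia.
  + exact: represents_set_arr.
- move=> i s conf hi hr /code_at_cons[/steps1 st _].
  exists 1; eexists; split; [by [] | exact: st | by rewrite /= addn1 |].
  case: (hr) => h1 h2 h3 h4 /=; rewrite h3.
  have := @represents_set_var i 1 0 (next_symbol (tape s)) s conf hi hr.
  by case=> g1 g2 _ _; split=> //=; rewrite h3.
- move=> i s conf hi hr /code_at_cons[/steps1 st _].
  exists 1; eexists; split; [by [] | exact: st | by rewrite /= addn1 |].
  by case: (hr) => h1 h2 h3 h4; split=> //=; rewrite h1 // h4.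
- by move=> s conf _ hr _; exists 0, conf; split=> //; rewrite addn0.
- move=> c d s s' s'' _ IHc _ IHd conf /= /andP[hc hd] hr /code_at_cat[].
  rewrite size_compile => hcc hcd.
  have [k [c' [t1 st1 e1 r1]]] := IHc _ hc hr hcc; rewrite -e1 in hcd.
  have [k' [c'' [t2 st2 e2 r2]]] := IHd _ hd r1 hcd.
  exists (k + k'), c''; split=> //; [lia | exact: steps_trans st2 | lia].
- move=> j c d s s' hj _ IH conf /and3P[vj hc hd] hr.
  rewrite -[compile _ _]/(IJump _ _ :: compile _ d ++ goto _ ++ compile _ c).
  case/code_at_cons=> /steps1 st /code_at_cat[_ /code_at_cat[_]].
  rewrite size_compile -[size (goto _)]/2 => ha.
  have h := hr; case: (hr) => hv _ _ _; rewrite /= hv // hj in st.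
  set c1 := Config _ _ _ _ _ in st.
  have r1 : represents (tick 1 s) c1 by [].
  have := IH _ hc r1; rewrite /= (_ : (pc conf).+1 + csize d + 2 = pc conf + 3
    + csize d) in ha *; last lia.
  case/(_ ha) => k [c' [t1 st1 e1 r']].
  by exists (1 + k), c'; split=> //; [rewrite t1 /=;
    lia | exact: steps_trans st1 | lia].
- move=> j c d s s' hj _ IH conf /and3P[vj hc hd] hr.
  rewrite -[compile _ _]/(IJump _ _ :: compile _ d ++ goto _ ++ compile _ c).
  case/code_at_cons=> /steps1 st /code_at_cat[ha /code_at_cat[hg _]].
  case: (hr) => hv _ _ _; rewrite /= hv // (negbTE hj) in st.
  set c1 := Config _ _ _ _ _ in st.
  have r1 : represents (tick 1 s) c1 by [].
  have [k [c' [t1 st1 e1 r']]] := IH _ hd r1 ha.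
  rewrite size_compile -[_.+1 + _]e1 in hg.
  have [c'' [st2 e2 r2]] := steps_goto r' hg.
  exists (1 + (k + 2)), c''; split=> //; [rewrite /= t1 /=;
    lia | | rewrite e2 /=; lia].
  by apply: (steps_trans st); apply: (steps_trans st1).
- move=> j c s s' s'' hj _ IHc _ IHw conf hwf hr ha0.
  case/andP: (hwf) => vj hc; have := ha0.
  rewrite -[compile _ _]/(IJump _ _ :: goto _ ++ compile _ c ++ goto _).
  case/code_at_cons=> /steps1 st /code_at_cat[_ /code_at_cat[]].
  rewrite -[size (goto _)]/2 => ha hg.
  case: (hr) => hv _ _ _; rewrite /= hv // hj in st.
  set c1 := Config _ _ _ _ _ in st.
  have r1 : represents (tick 1 s) c1 by [].
  have := IHc _ hc r1; rewrite /= (_ : (pc conf).+1 + 2 = pc conf + 3) in ha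
    hg *; last lia.
  case/(_ ha) => k [c' [t1 st1 e1 r']].
  rewrite size_compile -e1 in hg.
  have [c'' [st2 e2 r2]] := steps_goto r' hg.
  have := IHw c'' hwf; rewrite e2 => /(_ r2 ha0) [k' [c3 [t3 st3 e3 r3]]].
  exists (1 + (k + (2 + k'))), c3; split=> //; first by rewrite t3 /= t1 /=;
    lia.
  apply: (steps_trans st); apply: (steps_trans st1).
  exact: (steps_trans st2).
- move=> j c s hj conf /andP[vj hc] hr.
  rewrite -[compile _ _]/(IJump _ _ :: goto _ ++ compile _ c ++ goto _).
  case/code_at_cons=> /steps1 st hg.
  case: (hr) => hv _ _ _; rewrite /= hv // (negbTE hj) in st.
  set c1 := Config _ _ _ _ _ in st.
  have r1 : represents (tick 1 s) c1 by [].
  have hg' : code_at M (pc c1) (goto (pc conf + 5 + csize c)).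
    by case/code_at_cat: hg.
  have [c'' [st2 e2 r2]] := steps_goto r1 hg'.
  exists (1 + 2), c''; split=> //; first exact: steps_trans st2.
  by rewrite e2 /=; lia.
Qed.

(** [size r] is the budget both for steps and for cost, as in [halts_within]. The machine halts
    after [time s] steps and ignores the remaining coins; [clock_run] turns the step count into the
    quadratic cost of the hypothesis. *)
Lemma run_compile (c : cmd) (x r : seq bool) (s : state) (B : nat) :
  let M := compile 0 c in
  wf c -> ev c (State (fun=> 0%R) (fun _ _ => 0%R) x [::] 0) s -> 2 <= B ->
  code_bound B (onth M) -> 2 * time s * (B + time s).+1 <= size r ->
  [/\ halted M (run M x r), clock (run M x r) <= size r
    & out (run M x r) = printed s].
Proof.
move=> M hwf he B2 hB hsz.
have r0 : represents (State (fun=> 0%R) (fun _ _ => 0%R) x [::] 0) (init x).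
  by [].
have [//|k [c' [/= tk st epc [_ _ _ eo]]]] :=
  compile_correct (M := M) he hwf r0; rewrite add0n in tk epc.
have hs : k <= size r.
  apply: leq_trans hsz; rewrite tk -[X in X <= _]muln1.
  by apply: leq_mul; rewrite // leq_pmull.
have hc' : code_halted (onth M) c'.
  by rewrite /code_halted /code_exec epc onth_default // size_compile.
have run_k : code_run (onth M) (init x) (take k r) = c'.
  rewrite code_run_deterministic ?deterministic_compile //.
  by rewrite size_takel.
have -> : run M x r = c'.
  by rewrite runE -(cat_take_drop k r) code_run_cat run_k code_run_halted.
split=> //; rewrite -run_k.
apply: leq_trans (clock_run _ B2 hB (small_regs_init B x)) _.
rewrite add0n size_takel //; apply: leq_trans hsz.
by rewrite tk mulnCA mulnA.
Qed.

(** * Total-correctness rules and syntactic frame conditions *)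

Definition wp (c : cmd) (s : state) (Q : state -> Prop) : Prop :=
  exists s', ev c s s' /\ Q s'.

Lemma wp_weaken (c : cmd) (s : state) (Q Q' : state -> Prop) :
  wp c s Q -> (forall s', Q s' -> Q' s') -> wp c s Q'.
Proof. by move=> [s' [? ?]] h; exists s'; split=> //; apply: h. Qed.

Lemma wp_const (i : nat) (z : int) (s : state) (Q : state -> Prop) :
  Q (set_var i z 1 s) -> wp (Const i z) s Q.
Proof. by move=> h; eexists; split; [constructor | exact: h]. Qed.

Lemma wp_add (i j k : nat) (s : state) (Q : state -> Prop) :
  Q (set_var i (var s j + var s k)%R 1 s) -> wp (Add i j k) s Q.
Proof. by move=> h; eexists; split; [constructor | exact: h]. Qed.

Lemma wp_sub (i j k : nat) (s : state) (Q : state -> Prop) :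
  Q (set_var i (var s j - var s k)%R 1 s) -> wp (Sub i j k) s Q.
Proof. by move=> h; eexists; split; [constructor | exact: h]. Qed.

Lemma wp_get (n i a k : nat) (s : state) (Q : state -> Prop) :
  var s k = Posz n -> Q (set_var i (arr s a n) 6 s) -> wp (Get i a k) s Q.
Proof. by move=> e h; eexists; split; [apply: ev_get e | exact: h]. Qed.

Lemma wp_put (n a k i : nat) (s : state) (Q : state -> Prop) :
  var s k = Posz n -> Q (set_arr a n (var s i) 6 s) -> wp (Put a k i) s Q.
Proof. by move=> e h; eexists; split; [apply: ev_put e | exact: h]. Qed.

Lemma wp_read (i : nat) (s : state) (Q : state -> Prop) :
  Q (State (upd (var s) i (next_symbol (tape s))) (arr s)
           (behead (tape s)) (printed s) (time s + 1)) -> wp (Read i) s Q.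
Proof. by move=> h; eexists; split; [constructor | exact: h]. Qed.

Lemma wp_print (i : nat) (s : state) (Q : state -> Prop) :
  Q (State (var s) (arr s) (tape s) (rcons (printed s) (var s i))
           (time s + 1)) -> wp (Print i) s Q.
Proof. by move=> h; eexists; split; [constructor | exact: h]. Qed.

Lemma wp_skip (s : state) (Q : state -> Prop) : Q s -> wp Skip s Q.
Proof. by move=> h; eexists; split; [constructor | exact: h]. Qed.

Lemma wp_seq (c d : cmd) (s : state) (Q : state -> Prop) :
  wp c s (fun s' => wp d s' Q) -> wp (Seq c d) s Q.
Proof. by move=> [s' [? [s'' [? ?]]]]; exists s''; split=> //; econstructor;
  eauto. Qed.

Lemma wp_if (j : nat) (c d : cmd) (s : state) (Q : state -> Prop) :
  ((0 < var s j)%R -> wp c (tick 1 s) Q) ->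
  ((var s j <= 0)%R -> wp d (tick 1 s) (fun s' => Q (tick 2 s'))) ->
  wp (If j c d) s Q.
Proof.
move=> h1 h2; case: (ltP 0%R (var s j)) => hj.
  by have [s' [? ?]] := h1 hj; exists s'; split=> //; apply: ev_if_true.
have [s' [? ?]] := h2 hj; exists (tick 2 s'); split=> //.
by apply: ev_if_false; rewrite -?leNgt.
Qed.

(* [I k] holds when exactly [k] iterations remain. *)
Lemma wp_while (I : nat -> state -> Prop) (m j : nat) (c : cmd) (s : state)
    (Q : state -> Prop) :
  (forall k s, I k.+1 s ->
     (0 < var s j)%R /\ wp c (tick 1 s) (fun s' => I k (tick 2 s'))) ->
  (forall s, I 0 s -> (var s j <= 0)%R /\ Q (tick 3 s)) ->
  I m s -> wp (While j c) s Q.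
Proof.
move=> hS h0; elim: m s => [|m IH] s.
  move=> /h0[hj hQ]; exists (tick 3 s); split=> //.
  by apply: ev_while_false; rewrite -leNgt.
move=> /hS[hj [s' [he /IH[s'' [he' hQ]]]]]; exists s''; split=> //.
exact: (ev_while_true hj he he').
Qed.

Fixpoint written_vars (c : cmd) : seq nat :=
  match c with
  | Const i _ | Add i _ _ | Sub i _ _ | Get i _ _ | Read i => [:: i]
  | Put _ _ _ | Print _ | Skip => [::]
  | Seq c d | If _ c d => written_vars c ++ written_vars d
  | While _ c => written_vars c
  end.

Fixpoint written_arrs (c : cmd) : seq nat :=
  match c with
  | Put a _ _ => [:: a]
  | Seq c d | If _ c d => written_arrs c ++ written_arrs d
  | While _ c => written_arrs c
  | _ => [::]
  end.

Fixpoint silent (c : cmd) : bool :=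
  match c with
  | Print _ => false
  | Seq c d | If _ c d => silent c && silent d
  | While _ c => silent c
  | _ => true
  end.

Fixpoint loop_free (c : cmd) : bool :=
  match c with
  | Seq c d | If _ c d => loop_free c && loop_free d
  | While _ _ => false
  | _ => true
  end.

(** The value at [While] is a dummy, as the bound is claimed for loop-free commands only. *)
Fixpoint cost (c : cmd) : nat :=
  match c with
  | Get _ _ _ | Put _ _ _ => 6
  | Skip | While _ _ => 0
  | Seq c d => cost c + cost d
  | If _ c d => 3 + maxn (cost c) (cost d)
  | _ => 1
  end.

(** What the syntax alone guarantees. Specifications can then mention only what a command changes,
    and the rest is recovered by computing the written variables and arrays. *)
Definition frame (c : cmd) (s s' : state) : Prop :=
  [/\ forall i, i \notin written_vars c -> var s' i = var s i,
      forall a i, a \notin written_arrs c -> arr s' a i = arr s a i,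
      silent c -> printed s' = printed s
    & loop_free c -> time s' <= time s + cost c].

Lemma ev_frame (c : cmd) (s s' : state) : ev c s s' -> frame c s s'.
Proof.
elim=> {c s s'} //=; try by [split=> //= *; rewrite /upd; case: eqP => // e;
  match goal with h : is_true (_ \notin _) |- _ => move: h end;
  rewrite e inE eqxx].
- by move=> s; split=> //; rewrite addn0.
- move=> c d s s' s'' _ [h1 h2 h3 h4] _ [g1 g2 g3 g4]; split=> /=.
  + by move=> i; rewrite mem_cat negb_or => /andP[? ?]; rewrite g1 ?h1.
  + by move=> a i; rewrite mem_cat negb_or => /andP[? ?]; rewrite g2 ?h2.
  + by case/andP=> ? ?; rewrite g3 ?h3.
  + by case/andP=> /h4 ? /g4; lia.
- move=> j c d s s' _ _ [h1 h2 h3 h4]; split=> /=.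
  + by move=> i; rewrite mem_cat negb_or => /andP[? ?]; rewrite h1.
  + by move=> a i; rewrite mem_cat negb_or => /andP[? ?]; rewrite h2.
  + by case/andP=> ? ?; rewrite h3.
  + by case/andP=> ? ?; move: h4 => /=; lia.
- move=> j c d s s' _ _ [h1 h2 h3 h4]; split=> /=.
  + by move=> i; rewrite mem_cat negb_or => /andP[? ?]; rewrite h1.
  + by move=> a i; rewrite mem_cat negb_or => /andP[? ?]; rewrite h2.
  + by case/andP=> ? ?; rewrite h3.
  + by case/andP=> ? ?; move: h4 => /=; lia.
- move=> j c s s' s'' _ _ [h1 h2 h3 h4] _ [g1 g2 g3 g4]; split=> /=.
  + by move=> i hi; rewrite g1 ?h1.
  + by move=> a i hi; rewrite g2 ?h2.
  + by move=> hs; rewrite g3 ?h3.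
  + by [].
Qed.

Lemma wp_frame (c : cmd) (s : state) (Q : state -> Prop) :
  wp c s Q -> wp c s (fun s' => Q s' /\ frame c s s').
Proof. by move=> [s' [he ?]]; exists s'; do !split=> //;
  case: (ev_frame he). Qed.

(** * An interpreter *)

Notation "c ;; d" := (Seq c d) (at level 60, right associativity).

Notation v_one := 1 (only parsing).    (* holds the constant 1 *)
Notation v_pc := 2 (only parsing).
Notation v_hp := 3 (only parsing).     (* input head *)
Notation v_on := 4 (only parsing).     (* length of the output *)
Notation v_ov := 5 (only parsing).     (* last output *)
Notation v_off := 6 (only parsing).    (* register a is entry v_off + a *)
Notation v_run := 7 (only parsing).    (* 0 once the machine has halted *)
Notation v_bits := 8 (only parsing).   (* coins: digits of v_bits / v_P *)
Notation v_P := 9 (only parsing).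
Notation v_coin := 10 (only parsing).
Notation v_op := 11 (only parsing).
Notation v_f1 := 12 (only parsing).
Notation v_f2 := 13 (only parsing).
Notation v_f3 := 14 (only parsing).
Notation v_x1 := 15 (only parsing).
Notation v_x2 := 16 (only parsing).
Notation v_x3 := 17 (only parsing).
Notation v_y := 18 (only parsing).
Notation v_dst := 19 (only parsing).
Notation v_npc := 20 (only parsing).
Notation v_e := 21 (only parsing).
Notation v_idx := 22 (only parsing).
Notation v_zero := 23 (only parsing).  (* never written, hence 0 *)

(** Without halving, digits are extracted from the top by doubling the dividend. As only positivity
    can be tested, [P <= bits] is decided by the sign of [bits - P + 1]; the same trick recurs
    below. *)
Definition next_bit : cmd :=
  Add v_bits v_bits v_bits;;
  Sub v_e v_bits v_P;; Add v_e v_e v_one;;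
  If v_e (Sub v_bits v_bits v_P;; Const v_coin 1%R) (Const v_coin 0%R).

(* The default effect of an instruction, prepared here, is to write the
   register X_f1 back to itself and to go to the next instruction. *)
Definition fetch (mem cod : nat) : cmd :=
  Const v_run 1%R;;
  Add v_idx v_pc v_pc;; Add v_idx v_idx v_idx;; Get v_op cod v_idx;;
  Add v_idx v_idx v_one;; Get v_f1 cod v_idx;;
  Add v_idx v_idx v_one;; Get v_f2 cod v_idx;;
  Add v_idx v_idx v_one;; Get v_f3 cod v_idx;;
  Add v_idx v_off v_f1;; Get v_x1 mem v_idx;; Get v_y mem v_idx;;
  Add v_idx v_off v_f2;; Get v_x2 mem v_idx;;
  Add v_idx v_off v_f3;; Get v_x3 mem v_idx;;
  Add v_dst v_f1 v_zero;; Add v_npc v_pc v_one.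

(* Runs the n-th command of l, n being the value of v_j; values past the end
   select the last one. *)
Fixpoint switch (j : nat) (l : seq cmd) : cmd :=
  match l with
  | [::] => Skip
  | [:: c] => c
  | c :: l' => If j (Sub j j v_one;; switch j l') c
  end.

(** The default write-back stays in place, so a halted machine is left unchanged, in agreement with
    [code_step]. *)
Definition stop : cmd := Const v_run 0%R;; Add v_npc v_pc v_zero.

(** Adding 1 before the test separates nonnegative addresses from negative ones, which halt the
    machine. *)
Definition execute (mem tap : nat) : cmd :=
  switch v_op
    [:: stop
      ; Sub v_y v_f2 v_f3
      ; Add v_y v_x2 v_x3
      ; Sub v_y v_x2 v_x3
      ; Add v_e v_x2 v_one;;
        If v_e (Add v_idx v_off v_x2;; Get v_y mem v_idx) stop
      ; Add v_e v_x1 v_one;;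
        If v_e (Add v_dst v_x1 v_zero;; Add v_y v_x2 v_zero) stop
      ; If v_x2 (Add v_npc v_f1 v_zero) Skip
      ; Get v_y tap v_hp;; Add v_hp v_hp v_one
      ; Add v_on v_on v_one;; Add v_ov v_x1 v_zero
      ; Add v_y v_coin v_zero].

Definition commit (mem : nat) : cmd :=
  Add v_idx v_off v_dst;; Put mem v_idx v_y;; Add v_pc v_npc v_zero.

Definition interp (mem cod tap : nat) : cmd :=
  next_bit;; fetch mem cod;; execute mem tap;; commit mem.

(* As program codes are lists of naturals, the constant of IConst is a
   difference.  Opcode 0 means halt. *)
Definition decode (op f1 f2 f3 : nat) : option instr :=
  match op with
  | 0 => None
  | 1 => Some (IConst f1 (Posz f2 - Posz f3)%R)
  | 2 => Some (IAdd f1 f2 f3)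
  | 3 => Some (ISub f1 f2 f3)
  | 4 => Some (ILoad f1 f2)
  | 5 => Some (IStore f1 f2)
  | 6 => Some (IJump f1 f2)
  | 7 => Some (IRead f1)
  | 8 => Some (IPrint f1)
  | _ => Some (IFlip f1)
  end.

Definition codes (g : nat -> int) (code : nat -> option instr) : Prop :=
  forall p, exists op f1 f2 f3 : nat,
    [/\ g (4 * p) = Posz op, g (4 * p + 1) = Posz f1, g (4 * p + 2) = Posz f2,
        g (4 * p + 3) = Posz f3 & code p = decode op f1 f2 f3].

Definition env (off P : nat) (s : state) : Prop :=
  [/\ var s v_one = 1%R, var s v_zero = 0%R, var s v_off = Posz off
    & var s v_P = Posz P].

(** Of the output only the length and the last entry are kept: enough to read off [t n], and to
    recognise the output consisting of a single 1. *)
Definition simulates (mem tap off : nat) (s : state) (c : config) : Prop :=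
  [/\ var s v_pc = Posz (pc c),
      forall a, arr s mem (off + a) = regs c a,
      exists2 h, var s v_hp = Posz h &
        forall i, arr s tap (h + i) = next_symbol (drop i (inp c)),
      var s v_on = Posz (size (out c))
    & var s v_ov = last 0%R (out c)].

Ltac simplify := rewrite /= /upd /=.

Ltac straight :=
  repeat (first [apply: wp_seq | apply: wp_const | apply: wp_add
                | apply: wp_sub | apply: wp_skip]; simplify).

Lemma wp_next_bit (off P w : nat) (s : state) :
  env off P s -> var s v_bits = Posz w ->
  wp next_bit s (fun s' =>
    var s' v_coin = Posz (P <= 2 * w) /\
    var s' v_bits = Posz (2 * w - (P <= 2 * w) * P)).
Proof.
move=> [e1 e2 e3 eP] ew.
rewrite /next_bit; straight.
apply: wp_if; rewrite /= /upd /= ew e1 eP => h; straight; rewrite ?ew ?eP.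
  by split; lia.
by split; lia.
Qed.

Record fetched (mem tap off : nat) (cod : nat -> option instr) (b : bool)
    (c : config) (s : state) : Prop := Fetched {
  ft_sim : simulates mem tap off s c;
  ft_one : var s v_one = 1%R;
  ft_zero : var s v_zero = 0%R;
  ft_off : var s v_off = Posz off;
  ft_run : var s v_run = 1%R;
  ft_coin : var s v_coin = Posz b;
  ft_dec : exists op f1 f2 f3 : nat, [/\ cod (pc c) = decode op f1 f2 f3,
    var s v_op = Posz op, var s v_f1 = Posz f1, var s v_f2 = Posz f2
    & [/\ var s v_f3 = Posz f3, var s v_x1 = regs c f1, var s v_y = regs c f1,
     var s v_x2 = regs c f2 & var s v_x3 = regs c f3] /\ var s v_dst = Posz f1];
  ft_npc : var s v_npc = Posz (pc c).+1 }.

Lemma wp_fetch (mem cod tap off P : nat) (code : nat -> option instr)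
    (b : bool) (s : state) (c : config) :
  env off P s -> simulates mem tap off s c -> codes (arr s cod) code ->
  var s v_coin = Posz b ->
  wp (fetch mem cod) s (fetched mem tap off code b c).
Proof.
move=> [e1 e2 e3 _] [h1 h2 [h h3 h3'] h4 h5] hc hb.
have [op [f1 [f2 [f3 [g0 g1 g2 g3 gd]]]]] := hc (pc c).
rewrite /fetch; straight.
apply: (@wp_get (4 * pc c)); first by rewrite /= /upd /= h1; lia.
straight.
apply: (@wp_get (4 * pc c + 1)); first by rewrite /= /upd /= h1 e1; lia.
straight.
apply: (@wp_get (4 * pc c + 2)); first by rewrite /= /upd /= h1 e1; lia.
straight.
apply: (@wp_get (4 * pc c + 3)); first by rewrite /= /upd /= h1 e1; lia.
straight.
apply: (@wp_get (off + f1)); first by rewrite /= /upd /= e3 g1; lia.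
straight.
apply: (@wp_get (off + f1)); first by rewrite /= /upd /= e3 g1; lia.
straight.
apply: (@wp_get (off + f2)); first by rewrite /= /upd /= e3 g2; lia.
straight.
apply: (@wp_get (off + f3)); first by rewrite /= /upd /= e3 g3; lia.
straight.
split; rewrite ?/simulates; simplify=> //.
- by split=> //; exists h.
- exists op, f1, f2, f3; rewrite ?h2 g0 g1 g2 g3 e2.
  by split=> //; split=> //; rewrite addr0.
- by rewrite h1 e1; lia.
Qed.

(** The postcondition must ignore time, since the chain of tests has a length depending on [n];
    [v_j] is consumed by the countdown. *)
Lemma wp_switch (j : nat) (l : seq cmd) (n : nat) (s : state)
    (Q : state -> Prop) :
  j != v_one -> var s j = Posz n -> var s v_one = 1%R ->
  (forall k s', Q s' -> Q (tick k s')) ->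
  (forall s', (forall i, i != j -> var s' i = var s i) -> arr s' = arr s ->
     wp (nth (last Skip l) l n) s' Q) ->
  wp (switch j l) s Q.
Proof.
move=> hj + + hQ; elim: l n s => [|c [|d l] IH] n s en e1 h.
- by have := h s; rewrite nth_nil; apply.
- by have := h s; case: n {en h} => [|n] /=; rewrite ?nth_nil; apply.
rewrite -[switch _ _]/(If j (Sub j j v_one;; switch j (d :: l)) c).
apply: wp_if; rewrite en => hn.
- case: n hn en h => // n _ en h.
  apply: wp_seq; apply: wp_sub; simplify; apply: (IH n) => /=.
  + by rewrite /upd eqxx en e1; lia.
  + by rewrite /upd (negbTE (_ : v_one != j)) // eq_sym.
  + move=> s' h1 h2; apply: h => [i hi|//].
    by rewrite h1 //= /upd (negbTE hi).
- case: n hn en h => // _ en h.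
  by apply: (wp_weaken (h (tick 1 s) _ _)) => // s'; apply: hQ.
Qed.

(** The situation between [execute] and [commit]: one write, of [v_y] to register [v_dst], is still
    pending, and [c] is the configuration after it. *)
Record executed (mem tap off : nat) (c : config) (run : bool) (s : state) :
    Prop := Executed {
  ex_mem : exists2 d, var s v_dst = Posz d & forall a,
    regs c a = if a == d then var s v_y else arr s mem (off + a);
  ex_npc : var s v_npc = Posz (pc c);
  ex_tape : exists2 h, var s v_hp = Posz h &
    forall i, arr s tap (h + i) = next_symbol (drop i (inp c));
  ex_on : var s v_on = Posz (size (out c));
  ex_ov : var s v_ov = last 0%R (out c);
  ex_zero : var s v_zero = 0%R;
  ex_off : var s v_off = Posz off;
  ex_run : var s v_run = Posz run }.

Lemma wp_execute (mem tap off : nat) (code : nat -> option instr)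
    (b : bool) (s : state) (c : config) :
  fetched mem tap off code b c s ->
  wp (execute mem tap) s (executed mem tap off (code_step code c b)
    (isSome (code_exec code b c))).
Proof.
case=> -[h1 h2 [h h3 h3'] h4 h5] e1 e0 eoff erun ecoin.
move=> [op [f1 [f2 [f3 [hd eop ef1 ef2 [[ef3 ex1 ey ex2 ex3] edst]]]]]] enpc.
apply: (@wp_switch _ _ op) => // [k s' []//|s' hv ha].
rewrite -{}ha in h2 h3'.
rewrite -?hv // in h1 h3 h4 h5 e1 e0 eoff erun ecoin ef1 ef2 ef3 ex1 ey ex2
  ex3 edst enpc.
move: hd; rewrite /code_step /code_exec => ->{eop hv s}.
have hmem : forall a, regs c a = if a == f1 then var s' v_y else arr s' mem
  (off + a).
  by move=> a; rewrite ey h2; case: eqP => [->|].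
have htape : exists2 h, var s' v_hp = Posz h &
    forall i, arr s' tap (h + i) = next_symbol (drop i (inp c)) by exists h.
(* Three cases halt: opcode 0 and the two accesses through a negative address. In the latter two
   [v_e] has already been overwritten. *)
have wp_stop s'' : (forall i, i != v_e -> var s'' i = var s' i) ->
    arr s'' = arr s' -> wp stop s'' (executed mem tap off c false).
  move=> hv ha; rewrite -?hv // in h1 h3 h4 h5 e1 e0 eoff edst hmem htape.
  rewrite -?ha in hmem htape.
  rewrite /stop; straight; split; simplify=> //; last by rewrite h1 e0 addr0.
  by exists f1.
case: op => [|[|[|[|[|[|[|[|[|op]]]]]]]]].
- exact: wp_stop.
- rewrite /=; straight; split; simplify=> //.
  by exists f1 => // a; rewrite /= ef2 ef3; case: eqP => [//|_]; rewrite h2.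
- rewrite /=; straight; split; simplify=> //.
  by exists f1 => // a; rewrite /= ex2 ex3; case: eqP => [//|_]; rewrite h2.
- rewrite /=; straight; split; simplify=> //.
  by exists f1 => // a; rewrite /= ex2 ex3; case: eqP => [//|_]; rewrite h2.
- rewrite /=; straight; apply: wp_if; simplify; rewrite ex2 e1.
  + case e: (regs c f2) => [a|a] he /=; last by lia.
    straight; apply: (@wp_get (off + a)).
      by simplify; rewrite eoff ex2 e.
    split; simplify=> //; exists f1 => // a'; simplify.
    by rewrite -!h2.
  + case e: (regs c f2) => [a|a] he /=; first by lia.
    by apply: (wp_weaken (wp_stop _ _ _)) => [i|//|s'' []//];
      rewrite /= /upd => /negbTE->.
- rewrite /=; straight; apply: wp_if; simplify; rewrite ex1 e1.
  + case e: (regs c f1) => [a|a] he /=; last by lia.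
    straight; split; simplify=> //.
    exists a; first by rewrite ex1 e e0 addr0.
    by move=> a'; rewrite h2 ex2 e0 addr0.
  + case e: (regs c f1) => [a|a] he /=; first by lia.
    by apply: (wp_weaken (wp_stop _ _ _)) => [i|//|s'' []//];
      rewrite /= /upd => /negbTE->.
- rewrite /=; straight; apply: wp_if; simplify; rewrite ex2 => hj; straight.
  + rewrite hj; split; simplify=> //; first by exists f1.
    by rewrite ef1 e0 addr0.
  + rewrite ltNge hj; split; simplify=> //; by exists f1.
- rewrite /=; straight; apply: (@wp_get h) => //; straight.
  split; simplify=> //.
  + exists f1 => // a; rewrite /= -h2; case: eqP => // _.
    by have := h3' 0; rewrite addn0 drop0 => ->.
  + exists h.+1 => [|i]; first by rewrite h3 e1; lia.
    by rewrite addSnnS h3' -drop1 drop_drop addn1.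
- rewrite /=; straight; split; simplify=> //.
  + by exists f1.
  + by rewrite h4 e1 size_rcons; lia.
  + by rewrite ex1 e0 addr0 last_rcons.
(* All opcodes from 9 on select the last command, by the default of [nth], as in the catch-all case
   of [decode]. *)
- rewrite [nth _ _ _](_ : _ = Add v_y v_coin v_zero);
    last by case: (op) => [|[]].
  straight; split; simplify=> //.
  by exists f1 => // a; rewrite /= ecoin e0 addr0; case: eqP => [//|_];
    rewrite h2.
Qed.

Lemma wp_commit (mem tap off : nat) (c : config) (run : bool) (s : state) :
  mem != tap -> executed mem tap off c run s ->
  wp (commit mem) s (fun s' =>
    simulates mem tap off s' c /\ var s' v_run = Posz run).
Proof.
move=> ne [[d ed hd] en [h eh hh] eon eov e0 eoff erun].
rewrite /commit; straight; apply: (@wp_put (off + d)).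
  by simplify; rewrite eoff ed.
straight; split; last by simplify.
split; simplify=> //.
- by rewrite en e0 addr0.
- by move=> a; rewrite /upd eqxx eqn_add2l hd.
- by exists h => // i; rewrite /upd eq_sym (negbTE ne) hh.
Qed.

Lemma wp_interp (mem cod tap off P w : nat) (code : nat -> option instr)
    (s : state) (c : config) :
  mem != tap -> env off P s -> codes (arr s cod) code ->
  simulates mem tap off s c -> var s v_bits = Posz w ->
  let b := P <= 2 * w in
  wp (interp mem cod tap) s (fun s' =>
    [/\ simulates mem tap off s' (code_step code c b),
        var s' v_run = Posz (isSome (code_exec code b c))
      & var s' v_bits = Posz (2 * w - b * P)]).
Proof.
move=> ne he hc hs hw b; rewrite /interp; apply: wp_seq.
apply: (wp_weaken (wp_frame (wp_next_bit he hw))) => s1 [[hb hw1] [fv fa _ _]].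
case: he => e1 e0 eoff eP; case: hs => [h1 h2 [h h3 h3'] h4 h5].
have ha : forall a i, arr s1 a i = arr s a i by move=> a i; apply: fa.
have hs1 : simulates mem tap off s1 c.
  split; rewrite ?fv //; first by move=> a; rewrite ha.
  by exists h => [|i]; rewrite ?fv // ha.
have hc1 : codes (arr s1 cod) code.
  by move=> p; rewrite !ha; apply: hc.
have he1 : env off P s1 by split; rewrite fv.
apply: wp_seq; apply: (wp_weaken (wp_frame (wp_fetch he1 hs1 hc1 hb))).
move=> s2 [h2' [fv2 _ _ _]].
apply: wp_seq; apply: (wp_weaken (wp_frame (wp_execute h2'))).
move=> s3 [h3'' [fv3 _ _ _]].
apply: (wp_weaken (wp_frame (wp_commit ne h3''))) => s4 [[? ?] [fv4 _ _ _]].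
by split=> //; rewrite fv4 // fv3 // fv2.
Qed.

(** * Bits, coin sequences and program codes *)

(* Binary digits of [w / P], most significant first, computed by doubling. *)
Fixpoint msb (P k w : nat) : seq bool :=
  if k is k'.+1 then
    (P <= 2 * w) :: msb P k' (2 * w - (P <= 2 * w) * P)
  else [::].

Lemma size_msb (P k w : nat) : size (msb P k w) = k.
Proof. by elim: k w => //= k IH w; rewrite IH. Qed.

(** The dividend is doubled while the divisor is fixed: after [i] digits the remaining number
    [u < 2 ^ k] appears as [u * 2 ^ i] over [2 ^ (i + k)]. This factor makes the inductions on [k]
    go through. *)
Lemma msbS_low (i k u : nat) : u < 2 ^ k ->
  msb (2 ^ (i + k.+1)) k.+1 (u * 2 ^ i) =
  false :: msb (2 ^ (i.+1 + k)) k (u * 2 ^ i.+1).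
Proof.
move=> lt; rewrite /= addSnnS.
have -> : (2 ^ (i + k.+1) <= 2 * (u * 2 ^ i)) = false.
  apply/negbTE; rewrite -ltnNge -addSnnS expnD mulnCA -expnS mulnC.
  by rewrite ltn_pmul2l ?expn_gt0.
by rewrite subn0 mulnCA -expnS.
Qed.

Lemma msbS_high (i k u : nat) : u < 2 ^ k ->
  msb (2 ^ (i + k.+1)) k.+1 ((2 ^ k + u) * 2 ^ i) =
  true :: msb (2 ^ (i.+1 + k)) k (u * 2 ^ i.+1).
Proof.
move=> lt; rewrite /= addSnnS.
have e : 2 * ((2 ^ k + u) * 2 ^ i) = 2 ^ (i + k.+1) + u * 2 ^ i.+1.
  by rewrite -addSnnS expnD mulnCA -expnS mulnDl mulnC.
by rewrite e leq_addr mul1n addKn.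
Qed.

Lemma msbE (i k u : nat) : u < 2 ^ k ->
  msb (2 ^ (i + k)) k (u * 2 ^ i) =
  [seq odd (u %/ 2 ^ j) | j <- rev (iota 0 k)].
Proof.
elim: k i u => // k IH i u lt.
have -> : rev (iota 0 k.+1) = k :: rev (iota 0 k) by rewrite -addn1 iotaD
  rev_cat.
rewrite map_cons.
case: (ltnP u (2 ^ k)) => h.
  by rewrite msbS_low // IH // divn_small.
have [v hv ->] : exists2 v, v < 2 ^ k & u = 2 ^ k + v.
  by exists (u - 2 ^ k); move: lt; rewrite expnS; lia.
rewrite msbS_high // IH // divnDl ?divnn ?expn_gt0 ?dvdnn // divn_small //.
congr (_ :: _); apply/eq_in_map => j; rewrite mem_rev mem_iota add0n => /= jk.
(* For [j < k] the top bit contributes the even number [2 ^ (k - j)] to the quotient, so the parity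
   is that of [v]. *)
rewrite divnDl ?dvdn_exp2l ?(ltnW jk) // oddD -expnB // ?(ltnW jk) //.
by rewrite oddX subn_eq0 leqNgt jk.
Qed.

Lemma msb_binary (n : nat) :
  msb (2 ^ (trunc_log 2 n).+1) (trunc_log 2 n).+1 n = binary n.
Proof.
have := @msbE 0 (trunc_log 2 n).+1 n; rewrite muln1 add0n => -> //.
exact: trunc_log_ltn.
Qed.

(** Recursion on the tree of coins mediates between the probability, a cardinality of tuples, and
    the loop of the decider over integers. *)
Fixpoint count_runs (code : nat -> option instr) (p : pred config) (k : nat)
    (c : config) : nat :=
  if k is k'.+1 then
    count_runs code p k' (code_step code c false) +
    count_runs code p k' (code_step code c true)
  else p c.

Lemma count_runs_msb (code : nat -> option instr) (p : pred config)
    (k : nat) (c : config) :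
  count_runs code p k c =
  \sum_(0 <= w < 2 ^ k) p (code_run code c (msb (2 ^ k) k w)).
Proof.
(* The lower half of the range has first coin 0 and the upper half first coin 1; the shift [i] is
   that of [msbS_low]. *)
suff h i : count_runs code p k c = \sum_(0 <= w < 2 ^ k)
    p (code_run code c (msb (2 ^ (i + k)) k (w * 2 ^ i))).
  by rewrite (h 0); apply: eq_bigr => w _; rewrite muln1.
elim: k c i => [|k IH] c i; first by rewrite big_nat1.
rewrite [LHS]/= (@big_cat_nat _ _ _ (2 ^ k)) //; last by rewrite leq_exp2l.
congr (_ + _).
  rewrite (IH _ i.+1) big_nat [in RHS]big_nat; apply: eq_bigr => w /andP[_ hw].
  by rewrite msbS_low.
have e : 2 ^ k.+1 - 2 ^ k = 2 ^ k by rewrite expnS; lia.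
rewrite (IH _ i.+1) -{2}[2 ^ k]add0n big_addn e.
rewrite big_nat [in RHS]big_nat; apply: eq_bigr => w /andP[_ hw].
by rewrite [w + _]addnC msbS_high.
Qed.

Lemma card_runs (code : nat -> option instr) (p : pred config) (k : nat)
    (c : config) :
  #|[set r : k.-tuple bool | p (code_run code c r)]| = count_runs code p k c.
Proof.
transitivity (\sum_(r : k.-tuple bool) p (code_run code c r)).
  rewrite -sum1_card big_mkcond; apply: eq_bigr => r _.
  by rewrite inE; case: (p _).
elim: k c => [|k IH] c.
  rewrite (eq_bigr (fun=> nat_of_bool (p c))); last by move=> r _;
    rewrite tuple0.
  by rewrite sum_nat_const card_tuple mul1n.
rewrite (reindex (fun bt : bool * k.-tuple bool => [tuple of bt.1 :: bt.2])) /=.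
  rewrite -(pair_big xpredT xpredT
    (fun b (t : k.-tuple bool) =>
      nat_of_bool (p (code_run code c (b :: t))))) /=.
  by rewrite big_bool /= addnC -!IH.
exists (fun t : k.+1.-tuple bool => (thead t, [tuple of behead t])).
  by move=> [b t] _; congr (_, _); apply: val_inj.
by move=> t _; rewrite [RHS]tuple_eta; apply: val_inj.
Qed.

(** Once every run has halted, a further coin doubles the count and keeps the proportion. This
    allows the [T n] coins of a machine to be compared with the [S] coins of [diag]. *)
Lemma count_runs_halted (code : nat -> option instr) (p : pred config)
    (k d : nat) (c : config) :
  (forall r : k.-tuple bool, code_halted code (code_run code c r)) ->
  count_runs code p (k + d) c = 2 ^ d * count_runs code p k c.
Proof.
elim: k c => [|k IH] c h.
  have hc : code_halted code c by have := h [tuple].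
  elim: d => [|d IHd]; first by rewrite mul1n.
  by rewrite /= !code_step_halted // add0n in IHd *; rewrite IHd expnS; lia.
rewrite /= !IH ?mulnDr // => r.
  exact: (h [tuple of true :: r]).
exact: (h [tuple of false :: r]).
Qed.

Lemma count_runs_eq (code code' : nat -> option instr) (p : pred config)
    (k : nat) (c : config) :
  code =1 code' -> count_runs code p k c = count_runs code' p k c.
Proof.
move=> e; elim: k c => //= k IH c; rewrite !IH.
by rewrite /code_step /code_exec e.
Qed.

(* Reads a list of unary numbers, each ended by a 0 bit; an unfinished last
   number is dropped, and trailing 0 bits only append zeros. *)
Fixpoint parse (acc : nat) (x : seq bool) : seq nat :=
  match x with
  | [::] => [::]
  | true :: x' => parse acc.+1 x'
  | false :: x' => acc :: parse 0 x'
  end.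

Definition unary (l : seq nat) : seq bool :=
  flatten [seq rcons (nseq a true) false | a <- l].

Lemma parse_unary (l : seq nat) (x : seq bool) :
  parse 0 (unary l ++ x) = l ++ parse 0 x.
Proof.
elim: l => // a l IH; rewrite /unary /= -catA cat_rcons.
suff h acc : parse acc (nseq a true ++ false :: (unary l ++ x)) =
    (acc + a) :: parse 0 (unary l ++ x) by rewrite h add0n IH.
by elim: a acc => [|a IHa] acc /=; rewrite ?addn0 // IHa addSnnS.
Qed.

Lemma parse_nseq_false (k : nat) : parse 0 (nseq k false) = nseq k 0.
Proof. by elim: k => //= k ->. Qed.

(** The gain from unary notation: the constants of the coded program are bounded by the input
    length, hence so is the memory of a run of [S] steps, up to the factor [2 ^ S]. *)
Lemma parse_le (acc i : nat) (x : seq bool) :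
  nth 0 (parse acc x) i <= acc + size x.
Proof.
elim: x acc i => [|[] x IH] acc i /=; rewrite ?nth_nil //.
  by rewrite -addSnnS.
by case: i => [|i] /=; rewrite ?leq_addr //; have := IH 0 i; lia.
Qed.

Definition instr_code (ins : instr) : seq nat :=
  match ins with
  | IConst i (Posz n) => [:: 1; i; n; 0]
  | IConst i (Negz n) => [:: 1; i; 0; n.+1]
  | IAdd i j k => [:: 2; i; j; k]
  | ISub i j k => [:: 3; i; j; k]
  | ILoad i j => [:: 4; i; j; 0]
  | IStore i j => [:: 5; i; j; 0]
  | IJump m j => [:: 6; m; j; 0]
  | IRead i => [:: 7; i; 0; 0]
  | IPrint i => [:: 8; i; 0; 0]
  | IFlip i => [:: 9; i; 0; 0]
  end.

Definition program_code (M : program) : seq nat := flatten [seq instr_code i |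
  i <- M].

Definition decode_at (g : nat -> nat) (p : nat) : option instr :=
  decode (g (4 * p)) (g (4 * p + 1)) (g (4 * p + 2)) (g (4 * p + 3)).

(** Padding zeros decode to opcode 0, which halts just as leaving the program does. *)
Lemma decode_program (M : program) (k : nat) :
  decode_at (nth 0 (program_code M ++ nseq k 0)) =1 onth M.
Proof.
elim: M => [|ins M IH] p.
  by rewrite /decode_at /= !nth_nseq !if_same onth0n.
have sz : size (instr_code ins) = 4 by case: ins => // i [].
rewrite /program_code /= -catA -/(program_code M); case: p => [|p].
  by case: ins {sz} => // i [] n; rewrite /decode_at /= ?subr0 ?sub0r ?NegzE.
have e j : nth 0 (instr_code ins ++ program_code M ++ nseq k 0) (4 * p.+1 + j) =
    nth 0 (program_code M ++ nseq k 0) (4 * p + j).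
  by rewrite nth_cat sz ifF; [congr nth; lia | lia].
by rewrite [RHS](_ : _ = onth M p) // -IH /decode_at -{1}[4 * p.+1]addn0 !e
  addn0.
Qed.

Lemma codes_decode_at (g : nat -> nat) (g' : nat -> int) :
  (forall i, g' i = Posz (g i)) -> codes g' (decode_at g).
Proof.
by move=> e p; do 4!eexists; split; rewrite ?e //; reflexivity.
Qed.

Lemma code_bound_decode_at (g : nat -> nat) (B : nat) :
  (forall i, g i <= B) -> code_bound B (decode_at g).
Proof.
move=> h p ins; rewrite /decode_at;
  move: (h (4 * p + 1)) (h (4 * p + 2)) (h (4 * p + 3)).
move: (g (4 * p + 1)) (g (4 * p + 2)) (g (4 * p + 3)) => a b c ha hb hc.
move: (g (4 * p)) => [|[|[|[|[|[|[|[|[|n]]]]]]]]] //= [<-] //=; lia.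
Qed.

(** * The decider *)

Lemma wp_cost (c : cmd) (B : nat) (s : state) (Q : state -> Prop) :
  loop_free c -> cost c <= B -> wp c s Q ->
  wp c s (fun s' => Q s' /\ time s' <= time s + B).
Proof.
move=> lf hB /wp_frame h; apply: (wp_weaken h) => s' [? [_ _ _ /(_ lf) ht]].
by split=> //; apply: leq_trans ht _; rewrite leq_add2l.
Qed.

(** An iteration costs 3 steps besides its body, for the test and the jump back, and the exit costs
    3 more. The invariant ignores time, which is accounted for separately in [J]. *)
Lemma wp_loop (I : nat -> state -> Prop) (m B j : nat) (c : cmd) (s : state) :
  (forall k i s, I i s -> I i (tick k s)) ->
  (forall i s, I i.+1 s -> (0 < var s j)%R /\
     wp c s (fun s' => I i s' /\ time s' <= time s + B)) ->
  (forall s, I 0 s -> (var s j <= 0)%R) ->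
  I m s ->
  wp (While j c) s (fun s' => I 0 s' /\ time s' <= time s + m * (B + 3) + 3).
Proof.
move=> hT hS h0 hI.
pose J k s' := I k s' /\ time s' + k * (B + 3) <= time s + m * (B + 3).
apply: (@wp_while J m) => [k s1 [h1 h2]|s1 [h1 h2]|]; last by [].
  have [? _] := hS _ _ h1; split=> //.
  have [_ hw] := hS _ _ (hT 1 _ _ h1).
  apply: (wp_weaken hw) => s2 [? h3]; split; first exact: hT.
  by move: h2 h3; rewrite mulSn /=; lia.
split; first exact: h0.
by split; [exact: hT | move: h2 => /=; lia].
Qed.

Notation a_raw := 0 (only parsing).
Notation a_code := 1 (only parsing).
Notation a_tcode := 2 (only parsing).
Notation a_num := 3 (only parsing).
Notation a_tmem := 4 (only parsing).
Notation a_mem := 5 (only parsing).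

Notation v_n := 31 (only parsing).
Notation v_m := 32 (only parsing).
Notation v_acc := 33 (only parsing).
Notation v_s := 34 (only parsing).
Notation v_L := 35 (only parsing).
Notation v_d := 36 (only parsing).
Notation v_i := 37 (only parsing).
Notation v_T := 38 (only parsing).
Notation v_S := 39 (only parsing).
Notation v_Q := 40 (only parsing).
Notation v_j := 41 (only parsing).
Notation v_bal := 42 (only parsing).
Notation v_k := 43 (only parsing).

(** * Reading and parsing the input *)

Definition parse_symbol : cmd :=
  Put a_raw v_n v_s;; Add v_n v_n v_one;; Sub v_s v_s v_one;;
  If v_s (Add v_acc v_acc v_one)
    (Put a_code v_m v_acc;; Add v_m v_m v_one;; Const v_acc 0%R);;
  Read v_s.

(** The tape is read-once, whereas every simulated run reads the input anew: the symbols are stored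
    during the same pass that parses them. The symbol 0 past the end stops the loop. *)
Definition read_input : cmd :=
  Const v_one 1%R;; Read v_s;; While v_s parse_symbol.

Definition blank (x : seq bool) : state :=
  State (fun=> 0%R) (fun _ _ => 0%R) x [::] 0.

Lemma next_symbol_cat (x1 x2 : seq bool) (i : nat) :
  i < size x1 -> next_symbol (drop i (x1 ++ x2)) = next_symbol (drop i x1).
Proof. by move=> lt; rewrite drop_cat lt;
  case: (drop i x1) (size_drop i x1) => //=; lia. Qed.

Lemma next_symbol_rcons (x : seq bool) (b : bool) (i : nat) :
  next_symbol (drop i (rcons x b)) =
  if i == size x then Posz b.+1 else next_symbol (drop i x).
Proof.
rewrite -cats1; case: ltngtP => h.
- exact: next_symbol_cat.
- by rewrite !drop_oversize // ?size_cat /=; lia.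
- by rewrite h drop_size_cat.
Qed.

Record parsed (x x1 x2 : seq bool) (acc : nat) (l : seq nat) (s : state) :
  Prop := Parsed {
  pd_x : x = x1 ++ x2;
  pd_s : var s v_s = next_symbol x2;
  pd_tape : tape s = behead x2;
  pd_one : var s v_one = 1%R;
  pd_n : var s v_n = Posz (size x1);
  pd_raw : forall i, arr s a_raw i = next_symbol (drop i x1);
  pd_acc : var s v_acc = Posz acc;
  pd_m : var s v_m = Posz (size l);
  pd_code : forall i, arr s a_code i = Posz (nth 0 l i);
  pd_parse : parse 0 x = l ++ parse acc x2 }.

Lemma nth_rcons0 (l : seq nat) (a i : nat) :
  nth 0 (rcons l a) i = if i == size l then a else nth 0 l i.
Proof.
rewrite nth_rcons; case: ltngtP => // h.
by rewrite nth_default // ltnW.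
Qed.

Lemma wp_parse_symbol (x x1 x2 : seq bool) (b : bool) (acc : nat)
    (l : seq nat) (s : state) :
  parsed x x1 (b :: x2) acc l s ->
  wp parse_symbol s (fun s' => exists acc' l',
    parsed x (rcons x1 b) x2 acc' l' s').
Proof.
case=> ex es et e1 en eraw eacc em ecode ep.
rewrite /parse_symbol; apply: wp_seq; apply: (@wp_put (size x1)) => //.
straight; apply: wp_if; simplify; rewrite es.
- rewrite e1 => hb; straight; apply: wp_read; exists acc.+1, l.
  have {hb} eb : b = true by case: b hb {ex es et ep}.
  split; simplify; rewrite ?et ?size_rcons //.
  + by rewrite cat_rcons.
  + by rewrite en; lia.
  + by move=> i; rewrite next_symbol_rcons /upd eraw.
  + by rewrite eacc; lia.
  + by rewrite ep eb.
- rewrite e1 => hb; apply: wp_seq; apply: (@wp_put (size l)) => //.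
  straight; apply: wp_read; exists 0, (rcons l acc).
  have {hb} eb : b = false by case: b hb {ex es et ep}.
  split; simplify; rewrite ?et ?size_rcons //.
  + by rewrite cat_rcons.
  + by rewrite en; lia.
  + by move=> i; rewrite next_symbol_rcons /upd eraw.
  + by rewrite em; lia.
  + by move=> i; rewrite nth_rcons0 /upd ecode eacc; case: eqP.
  + by rewrite ep eb cat_rcons.
Qed.

Lemma wp_read_input (x : seq bool) :
  wp read_input (blank x) (fun s =>
    [/\ var s v_one = 1%R, var s v_n = Posz (size x),
        forall i, arr s a_raw i = next_symbol (drop i x),
        forall i, arr s a_code i = Posz (nth 0 (parse 0 x) i)
      & time s <= 5 + 30 * size x]).
Proof.
pose I k s := exists x1 x2 acc l, parsed x x1 x2 acc l s /\ size x2 = k.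
rewrite /read_input; straight; straight; apply: wp_read; simplify.
apply: (wp_weaken (@wp_loop I (size x) 27 _ _ _ _ _ _ _)).
- by move=> k i s [x1 [x2 [acc [l [[] ? ? ? ? ? ? ? ? ? ? ?]]]]];
    exists x1, x2, acc, l.
- move=> k s [x1 [[|b x2] [acc [l [hp]]]]] //= [hk].
  split; first by case: (hp) => _ ->.
  apply: wp_cost => //; apply: (wp_weaken (wp_parse_symbol hp)).
  by move=> s' [acc' [l' h]]; exists (rcons x1 b), x2, acc', l'.
- by move=> s [x1 [x2 [acc [l [[_ -> _ _ _ _ _ _ _ _] /size0nil->]]]]].
- exists [::], x, 0, [::]; split=> //.
  by split=> // i; rewrite ?nth_nil.
- move=> s [[x1 [x2 [acc [l [[ex _ _ e1 en eraw _ _ ecode ep] /size0nil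
    e2]]]]] /= ht].
  rewrite e2 cats0 in ep; rewrite e2 cats0 in ex.
  by split=> //; [rewrite en ex | rewrite ex | rewrite ep | lia].
Qed.

(** * The binary numeral of the input length *)

Definition double_P : cmd :=
  Add v_P v_P v_P;; Add v_L v_L v_one;; Sub v_d v_n v_P;; Add v_d v_d v_one.

(** Starting from one digit and [P = 2] gives 0 the one-digit numeral that [binary] prescribes. *)
Definition numeral_length : cmd :=
  Const v_L 1%R;; Const v_P 2%R;; Sub v_d v_n v_P;; Add v_d v_d v_one;;
  While v_d double_P.

Lemma trunc_log2_le (n : nat) : trunc_log 2 n <= n.
Proof.
case: n => // n.
by apply: leq_trans (ltnW (ltn_expl _ (isT : 1 < 2))) (trunc_logP _ _).
Qed.

Lemma wp_numeral_length (n : nat) (s : state) :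
  var s v_one = 1%R -> var s v_n = Posz n ->
  wp numeral_length s (fun s' =>
    [/\ var s' v_L = Posz (trunc_log 2 n).+1,
        var s' v_P = Posz (2 ^ (trunc_log 2 n).+1)
      & time s' <= time s + 10 + 10 * n]).
Proof.
move=> e1 en.
pose I k s := exists l, [/\ l + k = (trunc_log 2 n).+1, 0 < l,
  var s v_L = Posz l, var s v_P = Posz (2 ^ l) &
  [/\ var s v_d = (Posz n - Posz (2 ^ l) + 1)%R, var s v_one = 1%R
    & var s v_n = Posz n]].
have htl := trunc_log2_le n.
rewrite /numeral_length; straight.
apply: (wp_weaken (@wp_loop I (trunc_log 2 n) 4 _ _ _ _ _ _ _)).
- by move=> k i s1 [l [? ? ? ? [? ? ?]]]; exists l.
- move=> k s1 [l [el l0 eL eP [ed e1' en']]]; split.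
    have h : 2 ^ l <= n.
      case: (posnP n) => [n0|n0]; first by move: el; rewrite n0 trunc_log0; lia.
      by apply: leq_trans (trunc_logP (isT : 1 < 2) n0); rewrite leq_exp2l //;
        lia.
    by rewrite ed; lia.
  apply: wp_cost => //.
  rewrite /double_P; straight; exists l.+1; split; simplify=> //.
  + by lia.
  + by rewrite eL e1'; lia.
  + by rewrite eP expnS; lia.
  + by rewrite en' eP e1' expnS; split=> //; lia.
- move=> s1 [l [el l0 eL eP [ed e1' en']]].
  have h : n < 2 ^ l by rewrite -(addn0 l) el trunc_log_ltn.
  by rewrite ed; lia.
- exists 1; split; simplify=> //.
  by rewrite en e1.
- move=> s1 [[l [el l0 eL eP [ed e1' en']]] /= ht].
  by rewrite -el addn0; split=> //; lia.
Qed.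

(** Digits are stored increased by 1, as the input symbols of a machine; blank entries then act as
    the end of its tape. *)
Definition numeral_digit : cmd :=
  next_bit;; Add v_coin v_coin v_one;; Put a_num v_i v_coin;;
  Add v_i v_i v_one;; Sub v_d v_d v_one.

Definition numeral : cmd :=
  numeral_length;;
  Add v_bits v_n v_zero;; Add v_d v_L v_zero;; While v_d numeral_digit.

Lemma wp_numeral (n : nat) (s : state) :
  var s v_one = 1%R -> var s v_zero = 0%R -> var s v_off = 0%R ->
  var s v_i = 0%R -> (forall i, arr s a_num i = 0%R) -> var s v_n = Posz n ->
  wp numeral s (fun s' =>
    (forall i, arr s' a_num i = next_symbol (drop i (binary n))) /\
    time s' <= time s + 60 + 60 * n).
Proof.
move=> e1 e0 eoff ei ea en; rewrite /numeral; apply: wp_seq.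
apply: (wp_weaken (wp_frame (wp_numeral_length e1 en))).
move=> s1 [[eL eP ht] [fv fa _ _]]; set L := (trunc_log 2 n).+1 in eL eP.
pose I k s := exists r w, [/\ r ++ msb (2 ^ L) k w = binary n,
  var s v_bits = Posz w, env 0 (2 ^ L) s, var s v_d = Posz k &
  var s v_i = Posz (size r) /\ forall i,
    arr s a_num i = next_symbol (drop i r)].
have htl : L <= n.+1 by rewrite ltnS trunc_log2_le.
straight.
apply: (wp_weaken (@wp_loop I L 40 _ _ _ _ _ _ _)).
- by move=> k i s2 [r [w [? ? ? ? [? ?]]]]; exists r, w.
- move=> k s2 [r [w [er ew he ed [ei2 ea2]]]]; split; first by rewrite ed.
  apply: wp_cost => //.
  rewrite /numeral_digit; apply: wp_seq.
  apply: (wp_weaken (wp_frame (wp_next_bit he ew))).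
  case: (he) => e1' e0' eoff' eP'.
  move=> s3 [[eb ew3] [fv3 fa3 _ _]]; straight.
  apply: (@wp_put (size r)); first by simplify; rewrite fv3.
  straight; exists (rcons r (2 ^ L <= 2 * w)),
    (2 * w - (2 ^ L <= 2 * w) * 2 ^ L).
  split; simplify=> //.
  + by rewrite cat_rcons -er.
  + by split; simplify; rewrite fv3.
  + by rewrite !fv3 // ed e1'; lia.
  + rewrite size_rcons (fv3 v_i) // (fv3 v_one) // ei2 e1'; split; first by lia.
    move=> i; rewrite /upd next_symbol_rcons fa3 // ea2 eb.
    by case: eqP => // _; lia.
- by move=> s2 [r [w [_ _ _ -> _]]].
- exists [::], n; split; simplify=> //.
  + exact: msb_binary.
  + by rewrite !fv // en e0 addr0.
  + by split; simplify=> //; rewrite fv.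
  + by rewrite eL fv // e0 addr0.
  + by rewrite fv //; split=> // i; rewrite fa.
- move=> s2 [[r [w [er _ _ _ [_ h]]]] ht2].
  move: er; rewrite cats0 => <-; split=> //.
  by move: ht2 ht => /=; lia.
Qed.

Fixpoint write_list (a i : nat) (l : seq nat) : cmd :=
  if l is v :: l' then
    Const v_idx (Posz i);; Const v_e (Posz v);; Put a v_idx v_e;;
    write_list a i.+1 l'
  else Skip.

Lemma wp_write_list (a i : nat) (l : seq nat) (s : state) :
  wp (write_list a i l) s (fun s' =>
    forall k, arr s' a k =
      if i <= k < i + size l then Posz (nth 0 l (k - i)) else arr s a k).
Proof.
elim: l i s => [|v l IH] i s /=.
  by apply: wp_skip => k /=; rewrite ifF //; lia.
straight; apply: (@wp_put i) => //; simplify.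
apply: (wp_weaken (IH _ _)) => s' h k; rewrite h /= /upd eqxx.
case: (ltngtP i k) => hk /=.
- by rewrite addSnnS (_ : k - i = (k - i.+1).+1) //; lia.
- by [].
- by rewrite hk addnS ltnS leq_addr subnn.
Qed.

(** For a variable list the syntactic functions do not reduce, so the frame conditions must be
    stated. *)
Lemma write_list_facts (a i : nat) (l : seq nat) :
  [/\ loop_free (write_list a i l), silent (write_list a i l),
      written_vars (write_list a i l) = flatten (nseq (size l) [:: v_idx; v_e]),
      written_arrs (write_list a i l) = nseq (size l) a
    & cost (write_list a i l) = 8 * size l].
Proof.
by elim: l i => //= v l IH i; case: (IH i.+1) => -> -> -> -> ->; split=> //;
  lia.
Qed.

Lemma wf_write_list (a i : nat) (l : seq nat) : a < 8 -> wf (write_list a i l).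
Proof. by move=> ha; elim: l i => //= v l IH i; rewrite ha IH. Qed.

Lemma simulates_init (mem tap off : nat) (x : seq bool) (s : state) :
  var s v_pc = 0%R -> var s v_hp = 0%R -> var s v_on = 0%R ->
  var s v_ov = 0%R -> (forall a, arr s mem (off + a) = 0%R) ->
  (forall i, arr s tap i = next_symbol (drop i x)) ->
  simulates mem tap off s (init x).
Proof. by move=> *; split=> //; exists 0. Qed.

(** * Computing t(n), its square and the powers of 2 *)

(* With v_bits = 0 all coins are 0; it is used on a deterministic program. *)
Definition run_to_halt : cmd :=
  Const v_P 1%R;; Const v_bits 0%R;; Const v_run 1%R;;
  While v_run (interp a_tmem a_tcode a_num).

(** The bound [T] is unknown to the decider and serves only to prove termination. *)
Lemma wp_run_to_halt (code : nat -> option instr) (c : config) (T : nat)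
    (s : state) :
  var s v_one = 1%R -> var s v_zero = 0%R -> var s v_off = 0%R ->
  simulates a_tmem a_num 0 s c -> codes (arr s a_tcode) code ->
  let c' := code_run code c (nseq T false) in code_halted code c' ->
  wp run_to_halt s (fun s' => var s' v_ov = last 0%R (out c') /\
    time s' <= time s + 500 + 500 * T).
Proof.
move=> e1 e0 eoff hs hc /= hT.
pose c_ k := code_run code c (nseq k false).
have c_S k : c_ k.+1 = code_step code (c_ k) false.
  by rewrite /c_ -addn1 nseqD code_run_cat.
have [T' hT' minT'] := ex_minnP (ex_intro (fun k =>
  code_halted code (c_ k)) T hT).
have -> : code_run code c (nseq T false) = c_ T'.
  rewrite -(subnKC (minT' _ hT)) nseqD code_run_cat.
  exact: code_run_halted.
(* [T'] is the least halting time; the extra iteration is the one that finds no step to make and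
   clears [v_run]. *)
pose I k s := exists q, [/\ q + k = T'.+1, simulates a_tmem a_num 0 s (c_ q),
  var s v_run = Posz (0 < k), var s v_bits = 0%R &
  env 0 1 s /\ codes (arr s a_tcode) code].
rewrite /run_to_halt; straight.
apply: (wp_weaken (@wp_loop I T'.+1 250 _ _ _ _ _ _ _)).
- by move=> k i s1 [q [? ? ? ? [? ?]]]; exists q.
- move=> k s1 [q [eq hs1 er eb [he hc1]]]; split; first by rewrite er.
  apply: wp_cost => //.
  have h := @wp_interp a_tmem a_tcode a_num 0 1 0 code s1 (c_ q) isT he hc1
    hs1 eb.
  apply: (wp_weaken (wp_frame h)) => s2 [[hs2 er2 eb2] [fv fa _ _]].
  exists q.+1; split=> //; rewrite ?c_S //; first by rewrite addSnnS.
    rewrite er2 code_exec_coin; congr (Posz (nat_of_bool _)).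
    case: (ltnP q T') => hq; last first.
      have -> : q = T' by lia.
      by move: hT'; rewrite /code_halted => /negbTE->; lia.
    have : ~~ code_halted code (c_ q) by apply: contraL hq => /minT'; lia.
    by rewrite negbK => ->; lia.
  by split; [case: he => *; split; rewrite fv | move=> p; rewrite !fa //;
    apply: hc1].
- by move=> s1 [q [_ _ -> _ _]].
- exists 0; split; simplify=> //.
- move=> s1 [[q [eq [_ _ _ _ ->] _ _ _]] /= ht].
  have eT := minT' _ hT.
  rewrite (_ : q = T'.+1); last lia.
  by rewrite c_S code_step_halted //; split=> //; lia.
Qed.

Definition square : cmd :=
  Add v_T v_ov v_zero;; Add v_d v_T v_zero;;
  While v_d (Add v_S v_S v_T;; Sub v_d v_d v_one).

Lemma wp_square (T : nat) (s : state) :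
  var s v_one = 1%R -> var s v_zero = 0%R -> var s v_S = 0%R ->
  var s v_ov = Posz T ->
  wp square s (fun s' => var s' v_S = Posz (T * T) /\
    time s' <= time s + 10 + 10 * T).
Proof.
move=> e1 e0 eS eT.
pose I k s := [/\ var s v_d = Posz k, k <= T, var s v_S = Posz (T * (T - k)),
  var s v_one = 1%R & var s v_T = Posz T].
rewrite /square; straight.
apply: (wp_weaken (@wp_loop I T 2 _ _ _ _ _ _ _)).
- by [].
- move=> k s1 [ed kT eS1 e11 eT1]; split; first by rewrite ed.
  apply: wp_cost => //; straight; split; simplify=> //.
  + by rewrite ed e11; lia.
  + by lia.
  + by rewrite eS1 eT1; nia.
- by move=> s1 [-> _ _ _ _].
- split; simplify=> //; rewrite ?eT ?e0 ?addr0 //.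
  by rewrite eS subnn muln0.
- by move=> s1 [[_ _ -> _ _] /= ht]; rewrite subn0; split=> //; lia.
Qed.

(* 3 + n is one more than the bound n + 2 on the constants of a program coded in
   an input of length n, so v_Q exceeds every address used in S steps. *)
Definition powers : cmd :=
  Const v_P 1%R;; Const v_Q 3%R;; Add v_Q v_Q v_n;; Add v_d v_S v_zero;;
  While v_d (Add v_P v_P v_P;; Add v_Q v_Q v_Q;; Sub v_d v_d v_one).

Lemma wp_powers (n S : nat) (s : state) :
  var s v_one = 1%R -> var s v_zero = 0%R -> var s v_n = Posz n ->
  var s v_S = Posz S ->
  wp powers s (fun s' =>
    [/\ var s' v_P = Posz (2 ^ S), var s' v_Q = Posz (n.+3 * 2 ^ S)
      & time s' <= time s + 10 + 10 * S]).
Proof.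
move=> e1 e0 en eS.
pose I k s := exists q, [/\ q + k = S, var s v_d = Posz k,
  var s v_P = Posz (2 ^ q), var s v_Q = Posz (n.+3 * 2 ^ q)
  & var s v_one = 1%R].
rewrite /powers; straight.
apply: (wp_weaken (@wp_loop I S 3 _ _ _ _ _ _ _)).
- by move=> k i s1 [q [? ? ? ? ?]]; exists q.
- move=> k s1 [q [eq ed eP eQ e11]]; split; first by rewrite ed.
  apply: wp_cost => //; straight; exists q.+1; split; simplify=> //.
  + by lia.
  + by rewrite ed e11; lia.
  + by rewrite eP expnS; lia.
  + by rewrite eQ expnS; lia.
- by move=> s1 [q [_ -> _ _ _]].
- exists 0; split; simplify=> //; first by rewrite eS e0 addr0.
  by rewrite en; lia.
- move=> s1 [[q [eq _ eP eQ _]] /= ht].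
  by rewrite eP eQ -eq addn0; split=> //; lia.
Qed.

(** * The majority vote over all coin sequences *)

Definition simulate : cmd :=
  While v_k (interp a_mem a_code a_raw;; Sub v_k v_k v_one).

Lemma wp_simulate (code : nat -> option instr) (c : config)
    (off P S w : nat) (s : state) :
  env off P s -> codes (arr s a_code) code ->
  simulates a_mem a_raw off s c -> var s v_bits = Posz w ->
  var s v_k = Posz S ->
  wp simulate s (fun s' =>
    simulates a_mem a_raw off s' (code_run code c (msb P S w)) /\
    time s' <= time s + 5 + 300 * S).
Proof.
move=> he hc hs ew ek.
pose I k s := exists r w', [/\ r ++ msb P k w' = msb P S w,
  var s v_bits = Posz w', var s v_k = Posz k,
  simulates a_mem a_raw off s (code_run code c r)
  & env off P s /\ codes (arr s a_code) code].
rewrite /simulate.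
apply: (wp_weaken (@wp_loop I S 250 _ _ _ _ _ _ _)).
- by move=> k i s1 [r [w' [? ? ? ? [? ?]]]]; exists r, w'.
- move=> k s1 [r [w' [er ew1 ek1 hs1 [he1 hc1]]]]; split; first by rewrite ek1.
  apply: wp_cost => //; apply: wp_seq.
  have h := @wp_interp a_mem a_code a_raw off P w' code s1 _ isT he1 hc1 hs1
    ew1.
  apply: (wp_weaken (wp_frame h)) => s2 [[hs2 er2 eb2] [fv fa _ _]].
  straight; exists (rcons r (P <= 2 * w')), (2 * w' - (P <= 2 * w') * P).
  split; simplify=> //.
  + by rewrite cat_rcons.
  + case: he1 => e11 *; rewrite (fv v_k) // (fv v_one) // ek1 e11; lia.
  + by rewrite -cats1 code_run_cat.
  + split; first by case: he1 => *; split; simplify; rewrite fv.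
    by move=> p; rewrite /= !fa //; apply: hc1.
- by move=> s1 [r [w' [_ _ -> _ _]]].
- by exists [::], w.
- move=> s1 [[r [w' [er _ _ hs1 _]]] /= ht]; rewrite cats0 in er.
  by rewrite -er; split=> //; lia.
Qed.

Definition accepts : pred config := fun c => out c == [:: 1%R].

Definition tally : cmd :=
  Sub v_e v_on v_one;;
  If v_e (Sub v_bal v_bal v_one)
    (If v_on
      (Sub v_e v_ov v_one;;
       If v_e (Sub v_bal v_bal v_one)
         (If v_ov (Add v_bal v_bal v_one) (Sub v_bal v_bal v_one)))
      (Sub v_bal v_bal v_one)).

Lemma wp_tally (mem tap off : nat) (c : config) (s : state) :
  var s v_one = 1%R -> simulates mem tap off s c ->
  wp tally s (fun s' => var s' v_bal =
    (var s v_bal + Posz (2 * accepts c) - 1)%R).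
Proof.
move=> e1 [_ _ _ eon eov].
rewrite /tally; straight; apply: wp_if; simplify; rewrite eon e1 => h1.
  straight; rewrite e1 /accepts; case: eqP => [E|_]; last by lia.
  by move: h1; rewrite E.
straight; apply: wp_if; simplify; rewrite eon => h2; last first.
  straight; rewrite e1 /accepts; case: eqP => [E|_]; last by lia.
  by move: h2; rewrite E.
straight; apply: wp_if; simplify; rewrite eov e1 => h3.
  straight; rewrite e1 /accepts; case: eqP => [E|_]; last by lia.
  by move: h3; rewrite E.
straight; apply: wp_if; simplify; rewrite eov => h4; straight; rewrite e1.
  rewrite /accepts; case: (out c) h1 h2 h3 h4 => [|v [|? ?]] //= *.
  have -> : v = 1%R by lia.
  by rewrite eqxx; lia.
rewrite /accepts; case: eqP => [E|_]; last by lia.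
by move: h4; rewrite E.
Qed.

(* Run j uses the entries j Q, ..., (j + 1) Q - 1 of a_mem, which are still
   blank: no memory is ever cleared. *)
Definition trial : cmd :=
  Const v_pc 0%R;; Const v_hp 0%R;; Const v_on 0%R;; Const v_ov 0%R;;
  Add v_bits v_j v_zero;; Add v_k v_S v_zero;;
  simulate;; tally;;
  Add v_j v_j v_one;; Add v_off v_off v_Q;; Sub v_d v_d v_one.

Definition majority : cmd := Add v_d v_P v_zero;; While v_d trial.

Record trials (code : nat -> option instr) (x : seq bool) (S j : nat)
    (s : state) : Prop := Trials {
  tr_one : var s v_one = 1%R;
  tr_zero : var s v_zero = 0%R;
  tr_S : var s v_S = Posz S;
  tr_P : var s v_P = Posz (2 ^ S);
  tr_Q : var s v_Q = Posz ((size x).+3 * 2 ^ S);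
  tr_raw : forall i, arr s a_raw i = next_symbol (drop i x);
  tr_code : codes (arr s a_code) code;
  tr_j : var s v_j = Posz j;
  tr_off : var s v_off = Posz (j * ((size x).+3 * 2 ^ S));
  tr_mem : forall a, arr s a_mem (j * ((size x).+3 * 2 ^ S) + a) = 0%R;
  tr_bal : var s v_bal = (Posz (2 * \sum_(0 <= w < j)
    accepts (code_run code (init x) (msb (2 ^ S) S w))) - Posz j)%R }.

Lemma wp_trial (code : nat -> option instr) (x : seq bool) (S j : nat)
    (s : state) :
  code_bound (size x).+2 code -> trials code x S j s ->
  wp trial s (fun s' =>
    [/\ trials code x S j.+1 s', var s' v_d = (var s v_d - 1)%R
      & time s' <= time s + (50 + 300 * S)]).
Proof.
move=> hB [e1 e0 eS eP eQ hraw hcode ej eoff hmem ebal].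
set Q := (size x).+3 * 2 ^ S in eQ eoff hmem *.
rewrite /trial; straight.
set s0 := set_var _ _ _ _.
have hsim : simulates a_mem a_raw (j * Q) s0 (init x).
  by apply: simulates_init.
have he : env (j * Q) (2 ^ S) s0 by split.
have hj : var s0 v_bits = Posz j by rewrite /s0 /= /upd /= ej e0 addr0.
have hk : var s0 v_k = Posz S by rewrite /s0 /= /upd /= eS e0 addr0.
have hc0 : codes (arr s0 a_code) code by [].
apply: (wp_weaken (wp_frame (wp_simulate he hc0 hsim hj hk))).
move=> s1 [[hs1 ht1] [fv1 fa1 _ _]].
have e11 : var s1 v_one = 1%R by rewrite fv1.
apply: wp_seq; apply: (wp_weaken (wp_frame (wp_cost (B := 20) _ _ (wp_tally
  e11 hs1)))) => //.
move=> s2 [[eb2 ht2] [fv2 fa2 _ _]]; straight.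
split; last 1 first.
- by move: ht2 ht1; rewrite /s0 /=; lia.
- split; simplify.
  + by rewrite fv2.
  + by rewrite fv2 // fv1.
  + by rewrite fv2 // fv1.
  + by rewrite fv2 // fv1.
  + by rewrite fv2 // fv1.
  + by move=> i; rewrite fa2 // fa1 //; apply: hraw.
  + by move=> p; rewrite !fa2 // !fa1 //; apply: hcode.
  + by rewrite !fv2 // !fv1 // /s0 /= /upd /= ej e1; lia.
  + by rewrite !fv2 // !fv1 // /s0 /= /upd /= eoff eQ mulSn -/Q; lia.
  (* Entry [(j + 1) Q + a] is register [Q + a] of run [j]; it is blank because [Q] exceeds
     [(n + 2) 2^S], the bound of [small_regs_run]. *)
  + move=> a; rewrite fa2 //; case: hs1 => _ + _ _ _.
    rewrite mulSn addnAC addnC -/Q => ->.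
    have [_ h] := small_regs_run (msb (2 ^ S) S j) (isT : 2 <= (size x).+2) hB
      (small_regs_init _ x).
    apply: h; rewrite size_msb /Q mulSn addnAC -[X in X < _]add0n ltn_add2r.
    by rewrite addn_gt0 expn_gt0.
  + rewrite eb2 fv1 // /s0 /= /upd /= ebal big_nat_recr //=; lia.
- by simplify; rewrite !fv2 // !fv1 // /s0 /= /upd /= e1.
Qed.

Lemma wp_majority (code : nat -> option instr) (x : seq bool) (S : nat)
    (s : state) :
  code_bound (size x).+2 code -> trials code x S 0 s ->
  wp majority s (fun s' =>
    var s' v_bal = (Posz (2 * count_runs code accepts S (init x)) -
                    Posz (2 ^ S))%R /\
    time s' <= time s + 10 + 2 ^ S * (60 + 300 * S)).
Proof.
move=> hB h0.
pose I k s := exists j, [/\ j + k = 2 ^ S, var s v_d = Posz k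
  & trials code x S j s].
rewrite /majority; straight.
apply: (wp_weaken (@wp_loop I (2 ^ S) (50 + 300 * S) _ _ _ _ _ _ _)).
- by move=> k i s1 [j [? ? []]] *; exists j; split.
- move=> k s1 [j [ej ed hj]]; split; first by rewrite ed.
  apply: (wp_weaken (wp_trial hB hj)) => s2 [h ed2 ht]; split=> //.
  by exists j.+1; split=> //; [lia | rewrite ed2 ed; lia].
- by move=> s1 [j [_ -> _]].
- exists 0; split=> //; last by case: h0 => *; split.
  by simplify; case: h0 => _ -> _ -> *; rewrite addr0.
- move=> s1 [[j [ej _ h]] /= ht]; rewrite addn0 in ej.
  case: h => _ _ _ _ _ _ _ _ _ _ ->; rewrite ej count_runs_msb.
  by split=> //; lia.
Qed.

Definition decider (l : seq nat) : cmd :=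
  read_input;; numeral;; write_list a_tcode 0 l;; run_to_halt;; square;;
  powers;; majority;;
  Const v_e 1%R;; If v_bal (Const v_e 0%R) Skip;; Print v_e.

Definition program_of (x : seq bool) : nat -> option instr :=
  decode_at (nth 0 (parse 0 x)).

Lemma code_bound_program_of (x : seq bool) :
  code_bound (size x).+2 (program_of x).
Proof.
apply: code_bound_decode_at => i.
by apply: leq_trans (parse_le 0 i x) _; rewrite add0n; lia.
Qed.

Definition diag (t : nat -> nat) (x : seq bool) : bool :=
  let S := t (size x) * t (size x) in
  2 * count_runs (program_of x) accepts S (init x) <= 2 ^ S.

Lemma decider_time (l n T t S E t1 t2 t3 t4 t5 t6 t7 : nat) :
  t1 <= 5 + 30 * n -> t2 <= t1 + 60 + 60 * n -> t3 <= t2 + 8 * l ->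
  t4 <= t3 + 500 + 500 * T -> t5 <= t4 + 10 + 10 * t ->
  t6 <= t5 + 10 + 10 * S -> t7 <= t6 + 10 + E * (60 + 300 * S) ->
  t7 + 20 <= 1000 * (l.+1 + n + T + t + S + E * S.+1).
Proof. by rewrite mulnS mulnDr mulnCA; move: (E * S) => F; lia. Qed.

Lemma wp_decider (M : program) (t : nat -> nat) (x : seq bool) (T : nat) :
  let n := size x in let S := t n * t n in
  computes_within M (binary n) T [:: Posz (t n)] ->
  wp (decider (program_code M)) (blank x) (fun s =>
    printed s = answer (diag t x) /\
    time s <= 1000 * ((size (program_code M)).+1 + n + T + t n + S +
                      2 ^ S * S.+1)).
Proof.
move=> n S [hh ho]; set l := program_code M.
rewrite /decider; apply: wp_seq.
apply: (wp_weaken (wp_frame (wp_read_input x))).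
move=> s1 [[e1 en hraw hcode ht1] [fv1 fa1 fp1 _]].
apply: wp_seq.
apply: (wp_weaken (wp_frame (@wp_numeral n s1 e1 _ _ _ _ en))); rewrite ?fv1 //.
  by move=> i; rewrite fa1.
move=> s2 [[hnum ht2] [fv2 fa2 fp2 _]].
apply: wp_seq.
have [lf sl ew ea ec] := write_list_facts a_tcode 0 l.
apply: (wp_weaken (wp_frame (wp_write_list a_tcode 0 l s2))).
move=> s3 [htc [fv3 fa3 fp3 /(_ lf) ht3]]; rewrite {}ec in ht3.
have {}fv3 i : i \notin [:: v_idx; v_e] -> var s3 i = var s2 i.
  move=> hi; apply: fv3; rewrite ew; apply: contra hi => /flattenP[v].
  by rewrite mem_nseq => /andP[_ /eqP->].
have {}fa3 a i : a != a_tcode -> arr s3 a i = arr s2 a i.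
  by move=> ha; apply: fa3; rewrite ea mem_nseq (negbTE ha) andbF.
have hcodes : codes (arr s3 a_tcode) (onth M).
  move=> p; have [|op [f1 [f2 [f3 [g0 g1 g2 g3 gd]]]]] :=
      @codes_decode_at (nth 0 l) (arr s3 a_tcode) _ p.
    move=> i; rewrite htc /= add0n subn0; case: ltnP => // hi.
    by rewrite nth_default // fa2 // fa1.
  exists op, f1, f2, f3; split=> //.
  by rewrite -(decode_program M 0) cats0.
have hsim : simulates a_tmem a_num 0 s3 (init (binary n)).
  apply: simulates_init => [||||a|i].
  + by rewrite fv3 // fv2 // fv1.
  + by rewrite fv3 // fv2 // fv1.
  + by rewrite fv3 // fv2 // fv1.
  + by rewrite fv3 // fv2 // fv1.
  + by rewrite fa3 // fa2 // fa1.
  + by rewrite fa3 // hnum.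
(* The correctness of [M] holds for all coins, in particular for the zero coins that [run_to_halt]
   supplies. *)
have [hhalt _] := hh [tuple of nseq T false].
have hout := ho [tuple of nseq T false].
have [e31 e30 e3o] : [/\ var s3 v_one = 1%R, var s3 v_zero = 0%R
    & var s3 v_off = 0%R] by split; rewrite fv3 // fv2 // fv1.
apply: wp_seq.
apply: (wp_weaken (wp_frame (wp_run_to_halt e31 e30 e3o hsim hcodes hhalt))).
move=> s4 [[eov ht4] [fv4 fa4 fp4 _]]; rewrite -runE hout /= in eov.
have [e41 e40 e4S] : [/\ var s4 v_one = 1%R, var s4 v_zero = 0%R
    & var s4 v_S = 0%R] by split; rewrite fv4 // fv3 // fv2 // fv1.
apply: wp_seq; apply: (wp_weaken (wp_frame (wp_square e41 e40 e4S eov))).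
move=> s5 [[eS ht5] [fv5 fa5 fp5 _]].
have [e51 e50 e5n] : [/\ var s5 v_one = 1%R, var s5 v_zero = 0%R
    & var s5 v_n = Posz n].
  by split; rewrite fv5 // fv4 // fv3 // fv2 // fv1.
apply: wp_seq; apply: (wp_weaken (wp_frame (wp_powers e51 e50 e5n eS))).
move=> s6 [[eP eQ ht6] [fv6 fa6 fp6 _]].
have fa a i : a \notin [:: a_tcode; a_num; a_tmem] -> arr s6 a i = arr s1 a i.
  rewrite !inE => ha; rewrite fa6 // fa5 // fa4 ?fa3 ?fa2 //;
  by rewrite ?inE; move: ha; rewrite !negb_or => /and3P[].
have h6 : trials (program_of x) x S 0 s6.
  split; rewrite ?eP ?eQ // ?mul0n ?add0n ?big_geq // ?muln0.
  + by rewrite fv6.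
  + by rewrite fv6.
  + by rewrite fv6.
  + by move=> i; rewrite fa.
  + move=> p; rewrite !fa //.
    by apply: (@codes_decode_at (nth 0 (parse 0 x)) (arr s1 a_code)).
  + by rewrite fv6 // fv5 // fv4 // fv3 // fv2 // fv1.
  + by rewrite fv6 // fv5 // fv4 // fv3 // fv2 // fv1.
  + by move=> a; rewrite fa // fa1.
  + by rewrite fv6 // fv5 // fv4 // fv3 // fv2 // fv1.
apply: wp_seq.
apply: (wp_weaken (wp_frame (wp_majority (@code_bound_program_of x) h6))).
move=> s7 [[ebal ht7] [_ _ fp7 _]].
have ep : printed s7 = [::].
  by rewrite fp7 // fp6 // fp5 // fp4 // fp3 // fp2 // fp1.
have ht : time s7 + 20 <= 1000 * ((size l).+1 + n + T + t n + S + 2 ^ S * S.+1).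
  exact: decider_time ht1 ht2 ht3 ht4 ht5 ht6 ht7.
straight; apply: wp_if; simplify; rewrite ebal => hb; straight;
  apply: wp_print; simplify; rewrite ep; (split;
  last by apply: leq_trans ht; rewrite -?addnA leq_add2l).
- by rewrite /answer /diag -/n -/S leqNgt -ltz_nat -subr_gt0 hb.
- by rewrite /answer /diag -/n -/S -lez_nat -subr_le0 hb.
Qed.

(** * The theorem *)

Lemma exists_code_bound (M : program) :
  exists2 B, 2 <= B & code_bound B (onth M).
Proof.
pose b ins := match ins with
  | IConst i z => maxn i `|z|%N
  | IAdd i _ _ | ISub i _ _ | ILoad i _ | IRead i | IFlip i => i
  | _ => 0
  end.
exists (maxn 2 (\max_(ins <- M) b ins)); first by rewrite leq_maxl.
move=> p ins h.
have : b ins <= \max_(ins <- M) b ins.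
  elim: M p h => [|ins' M IH] [|p] //=; rewrite big_cons => h.
    by case: h => ->; apply: leq_maxl.
  by apply: leq_trans (IH _ h) (leq_maxr _ _).
move=> /leq_trans/(_ (leq_maxr 2 _)).
by case: ins {h} => //= *; rewrite -?geq_max.
Qed.

Lemma count_runs_empty (code : nat -> option instr) (p : pred config)
    (k : nat) (c : config) :
  code_halted code c -> ~~ p c -> count_runs code p k c = 0.
Proof.
move=> hc hp; elim: k => [|k IH] /=; first by rewrite (negbTE hp).
by rewrite !code_step_halted // IH.
Qed.

Lemma count_runs_disjoint (code : nat -> option instr) (p q : pred config)
    (k : nat) (c : config) :
  (forall c', p c' -> ~~ q c') ->
  count_runs code p k c + count_runs code q k c <= 2 ^ k.
Proof.
move=> h; elim: k c => [|k IH] c /=.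
  by have := h c; case: (p c) => [/(_ isT)/negbTE->|_] //; case: (q c).
rewrite addnACA expnS mul2n -addnn; exact: leq_add.
Qed.

Lemma diag_nonempty (t : nat -> nat) : ae_nonempty (diag t).
Proof.
exists 0 => n _; exists (nseq n false); split; first by rewrite size_nseq.
rewrite /diag count_runs_empty ?muln0 // /code_halted /code_exec.
by rewrite /program_of parse_nseq_false /decode_at !nth_nseq !if_same.
Qed.

Lemma prob_output_count (M : program) (x : seq bool) (T : nat) (o : seq int) :
  prob_output M x T o =
  ((count_runs (onth M) (fun c => out c == o) T (init x))%:R /
   (2 ^ T)%:R)%R.
Proof. by rewrite /prob_output -card_runs. Qed.

Lemma prob_output_ge (M : program) (x : seq bool) (T : nat) (o : seq int) :
  (2%:R / 3%:R <= prob_output M x T o)%R ->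
  2 * 2 ^ T <= 3 * count_runs (onth M) (fun c => out c == o) T (init x).
Proof.
rewrite prob_output_count ler_pdivlMr ?ltr0n ?expn_gt0 //.
rewrite mulrAC ler_pdivrMr ?ltr0n // -!natrM ler_nat.
by rewrite [_ * 3]mulnC.
Qed.

Lemma not_rand_decides (t T : nat -> nat) (M : program) (C N : nat) :
  (forall n, n < t n) -> (forall n, N <= n -> T n <= C * t n) ->
  ~ rand_decides_within M (diag t) T.
Proof.
move=> tgt hT hM; set u := unary (program_code M).
(* The padding brings the length above both the threshold [N] and the factor [C], whence
   [T n <= C * t n <= t n * t n]. *)
pose n := size u + N + C; pose x := u ++ nseq (N + C) false.
have sx : size x = n by rewrite size_cat size_nseq addnA.
have hp : program_of x =1 onth M.
  move=> p; rewrite /program_of /x /u parse_unary parse_nseq_false.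
  exact: decode_program.
have [hh hpr] := hM x; rewrite sx in hh hpr.
have hTS : T n <= t n * t n.
  apply: leq_trans (hT n _) _; first by rewrite /n; lia.
  by apply: leq_mul => //; apply: leq_trans (ltnW (tgt n)); rewrite /n; lia.
have hc := @count_runs_halted (onth M) accepts (T n) (t n * t n - T n) (init
  x) (fun r => (hh r).1).
rewrite subnKC // in hc; move: hpr.
rewrite /diag sx (count_runs_eq _ _ _ hp) hc -{2}(subnK hTS) expnD mulnCA.
(* Cancelling [2 ^ (S - T n)] leaves a vote among [2 ^ T n] runs. If at most half accept, the answer
   1 misses 2/3; if more than half accept, fewer than half are left for the answer 0. *)
rewrite leq_pmul2l ?expn_gt0 //; case: leqP => h /prob_output_ge.
  rewrite /answer /= -/accepts; move: h.
  by have := expn_gt0 2 (T n); rewrite orTb; lia.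
have := @count_runs_disjoint (onth M) accepts (fun c =>
  out c == answer false) (T n) (init x).
rewrite /accepts => /(_ _)/wrap[c' /eqP->//|].
move: h; rewrite /accepts; lia.
Qed.

(** * Asymptotic estimates *)

Lemma time_O_nat (R : realType) (T : nat -> nat) (g : nat -> R) :
  (forall n, 0 <= g n)%R ->
  time_O T g <-> exists C N : nat, forall n, N <= n ->
    ((T n)%:R <= C%:R * g n)%R.
Proof.
move=> g0; rewrite /time_O; split.
  move=> /eqO_exP[k k0 [N _ h]]; exists (Num.bound k), N => n hn.
  have := h n hn; rewrite /= ger0_norm // ger0_norm // => /le_trans; apply.
  by rewrite ler_wpM2r // ltW // archi_boundP // ltW.
(* The successor is taken because the constant of [eqO_exP] must be positive. *)
move=> [C [N h]]; apply/eqO_exP; exists C.+1%:R%R; first by rewrite ltr0n.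
exists N => // n hn; rewrite /= ger0_norm // ger0_norm //.
apply: le_trans (h n hn) _.
by rewrite ler_wpM2r // ler_nat.
Qed.

Lemma time_O_natE (R : realType) (T t : nat -> nat) :
  time_O T (fun n => (t n)%:R : R)%R <-> exists C N : nat, forall n, N <= n ->
    T n <= C * t n.
Proof.
rewrite time_O_nat; last by move=> n; rewrite ler0n.
by split=> -[C [N h]]; exists C, N => n /h; rewrite -natrM ler_nat.
Qed.

(* 2.01 = 2 + 1/100, and m^(1/100) is eventually above any constant. *)
Lemma powR_201_ge (R : realType) :
  exists N : nat, forall m : nat, N <= m ->
    ((4 * (m * m))%N%:R <= (m%:R : R) `^ (201%:R / 100%:R))%R.
Proof.
exists (Num.bound (4%:R `^ 100%:R : R))%R => m hm.
have h4 : (4%:R `^ 100%:R <= m%:R :> R)%R.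
  apply: le_trans (ltW (archi_boundP (powR_ge0 _ _))) _.
  by rewrite ler_nat.
have m0 : (0 < m%:R :> R)%R by apply: lt_le_trans h4; rewrite powR_gt0 // ltr0n.
have -> : (201%:R / 100%:R = 1 / 100%:R + 2%:R :> R)%R.
  by field.
rewrite powRD; last by rewrite gt_eqF ?implybT // gt_eqF.
rewrite powR_mulrn ?ler0n // !natrM -expr2 ler_pM2r ?exprn_gt0 //.
have -> : (4%:R = (4%:R `^ 100%:R) `^ (1 / 100%:R) :> R)%R.
  by rewrite -powRrM mulrCA divff ?mulr1 ?powRr1 ?ler0n ?pnatr_eq0.
by apply: ge0_ler_powR => //; rewrite ?nnegrE ?powR_ge0 ?divr_ge0 ?ler0n.
Qed.

(** Here [u] is [t(n)^2]. Each summand of the step count [N] is at most a constant times [F = 4^u];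
    the 4 in [K] counts [n], [t], [u] and [2 ^ u * u.+1]. The quadratic cost is then of order
    [F^2 = 2 ^ (4 * u)]. *)
Lemma leq_exp4 (B c C u n T t N K : nat) :
  n <= u -> t <= u -> T <= C * u ->
  N = 1000 * (c + n + T + t + u + 2 ^ u * u.+1) ->
  K = 1000 * (c + C + 4) ->
  2 * N * (B + N).+1 <= 2 * K * (B + K).+1 * 2 ^ (4 * u).
Proof.
move=> hn ht hT eN eK.
have hu : u.+1 <= 2 ^ u by apply: ltn_expl.
have e : 2 ^ (4 * u) = (2 ^ u * 2 ^ u) * (2 ^ u * 2 ^ u).
  by rewrite -!expnD; congr (_ ^ _); lia.
rewrite e; set E := 2 ^ u in eN hu *.
have h1 : u.+1 <= E * E by apply: leq_trans hu _; rewrite leq_pmulr; lia.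
have h3 : E * u.+1 <= E * E by rewrite leq_mul2l hu orbT.
have hN : N <= K * (E * E).
  rewrite eN eK -mulnA leq_mul2l /=; move: h1 h3.
  move: (E * E) (E * u.+1) => F G h1 h3.
  have : C * u <= C * F by rewrite leq_mul2l (ltnW h1) orbT.
  have : c <= c * F by rewrite leq_pmulr; lia.
  by rewrite !mulnDl; lia.
have F0 : 0 < E * E by lia.
move: (E * E) hN F0 => F hN F0.
rewrite [X in _ <= X]mulnACA; apply: leq_mul.
  by rewrite -mulnA leq_mul2l hN.
have : B.+1 <= B.+1 * F by rewrite leq_pmulr.
by rewrite -!addSn mulnDl; lia.
Qed.

Lemma not_rand_decidable_diag (R : realType) (t : nat -> nat) :
  (forall n, n < t n) ->
  ~ rand_decidable_in_time_O (diag t) (fun n => (t n)%:R%R : R).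
Proof.
move=> t_gt [M [T [/time_O_natE[C [N hT]] hM]]].
exact: not_rand_decides t_gt hT hM.
Qed.

Lemma det_decidable_diag (R : realType) (t : nat -> nat) :
  (forall n, n < t n) -> computable_in_time_O t (fun n => (t n)%:R%R : R) ->
  det_decidable_in_time_O (diag t)
    (fun n => (2%:R `^ ((t n)%:R `^ (201%:R / 100%:R)))%R : R).
Proof.
move=> t_gt [Mt [T [/time_O_natE[C [N hT]] [_ hMt]]]].
set l := program_code Mt.
have [B B2 hB] := exists_code_bound (compile 0 (decider l)).
pose steps n := 1000 * ((size l).+1 + n + T n + t n + t n * t n +
  2 ^ (t n * t n) * (t n * t n).+1).
exists (compile 0 (decider l)), (fun n => 2 * steps n * (B + steps n).+1).
split; last first.
  split=> [|x]; first exact: deterministic_compile.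
  have [s [he [hp ht]]] := @wp_decider Mt t x _ (hMt (size x)).
  have hwf : wf (decider l) by rewrite /= wf_write_list.
  have h (r : seq bool) : size r = 2 * steps (size x) * (B + steps (size
    x)).+1 ->
      [/\ halted (compile 0 (decider l)) (run (compile 0 (decider l)) x r),
        clock (run (compile 0 (decider l)) x r) <= size r
      & out (run (compile 0 (decider l)) x r) = answer (diag t x)].
    move=> sz; rewrite -hp; apply: (run_compile hwf he B2 hB).
    by rewrite sz; apply: leq_mul;
      [rewrite leq_mul2l ht | rewrite ltnS leq_add2l].
  split=> r; have [h1 h2 h3] := h r (size_tuple r); last exact: h3.
  by split=> //; rewrite -{2}(size_tuple r).
apply/time_O_nat => [n|]; first exact: powR_ge0.
have [N' hN'] := powR_201_ge R.
pose K := 1000 * ((size l).+1 + C + 4).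
exists (2 * K * (B + K).+1), (N + N') => n hn.
have ht2 : t n <= t n * t n by rewrite leq_pmulr // (leq_ltn_trans _ (t_gt n)).
have hle : 2 * steps n * (B + steps n).+1 <=
    2 * K * (B + K).+1 * 2 ^ (4 * (t n * t n)).
  apply: leq_exp4 (erefl _) (erefl _) => //; first by apply: leq_trans ht2;
    apply: ltnW.
  apply: leq_trans (hT n _) _; first by lia.
  by rewrite leq_mul2l ht2 orbT.
apply: (@le_trans _ _ (2 * K * (B + K).+1 * 2 ^ (4 * (t n * t n)))%:R%R).
  by rewrite ler_nat.
rewrite natrM ler_wpM2l ?ler0n // natrX -powR_mulrn ?ler0n //.
apply: ler_powR; first by rewrite ler1n.
by apply: hN'; have := t_gt n; lia.
Qed.

Local Open Scope ring_scope.

Theorem theorem3p6 (R : realType) (t : nat -> nat)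
    (t_gt : forall n : nat, (n < t n)%N)
    (t_computable : computable_in_time_O t (fun n => (t n)%:R : R)) :
  exists L : language,
    [/\ ae_nonempty L,
        ~ rand_decidable_in_time_O L (fun n => (t n)%:R : R)
      & det_decidable_in_time_O L
          (fun n => 2%:R `^ ((t n)%:R `^ (201%:R / 100%:R)) : R)].
Proof.
exists (diag t); split; first exact: diag_nonempty.
- exact: not_rand_decidable_diag.
- exact: det_decidable_diag.
Qed.
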